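(* Let $X$ be a transient random walk on $\mathbf{Z}^d$ started at $X_0=0$, with Green function $g$. Then, with probability one, $$\overline{\mathrm{Dim}}_{\mathrm M}(\mathcal{R}_X)=\gamma_c:=\inf\Big\{\gamma\in(0,d):\ \sum_{x\in\mathbf{Z}^d\setminus\{0\}}\frac{g(0,x)}{\|x\|^\gamma}<\infty\Big\},$$ with the convention $\inf\varnothing:=d$.
   Context: A random walk on $\mathbf{Z}^d$ is $X_n=X_0+\xi_1+\cdots+\xi_n$ with $\xi_1,\xi_2,\dots$ i.i.d. $\mathbf{Z}^d$-valued; $P^a$ denotes its law when $X_0=a$. Its Green function is $g(a,x):=\sum_{n\ge0}P^a\{X_n=x\}$, and transience means $g$ is finite. $\mathcal{R}_X:=\bigcup_{n\ge0}\{X_n\}$ is the range. For $k\ge0$, $\mathcal{V}_k:=[-2^k,2^k)^d$. The macroscopic upper Minkowski dimension of $A\subseteq\mathbf{Z}^d$ is $\overline{\mathrm{Dim}}_{\mathrm M}(A):=\limsup_{n\to\infty}n^{-1}\log_2\#(A\cap\mathcal{V}_n)$. $\|\cdot\|$ is the Euclidean norm. *)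

(* Defs.v *)
From Stdlib Require Import Reals Lra Lia ZArith List Classical ClassicalEpsilon.
Import ListNotations.
Open Scope R_scope.

Definition event (Omega : Type) := Omega -> Prop.

Definition is_prob_space (Omega : Type)
    (F : event Omega -> Prop) (P : event Omega -> R) : Prop :=
  F (fun _ => True) /\
  (forall A, F A -> F (fun w => ~ A w)) /\
  (forall A : nat -> event Omega, (forall n, F (A n)) ->
        F (fun w => exists n, A n w)) /\
  (forall A, F A -> 0 <= P A) /\
  P (fun _ => True) = 1 /\
  (forall A : nat -> event Omega, (forall n, F (A n)) ->
     (forall m n, m <> n -> forall w, A m w -> A n w -> False) ->
     infinite_sum (fun n => P (A n)) (P (fun w => exists n, A n w))).

(* ---------- the lattice Z^d: points are lists of length d ---------- *)
Definition vadd (u v : list Z) : list Z :=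
  map (fun p => (fst p + snd p)%Z) (combine u v).

Definition zerov (d : nat) : list Z := repeat 0%Z d.

Definition enorm (x : list Z) : R :=
  sqrt (fold_right Rplus 0 (map (fun z => (IZR z) ^ 2) x)).

Definition zrange (a : Z) (k : nat) : list Z :=
  map (fun i => (a + Z.of_nat i)%Z) (seq 0 k).

Fixpoint box (m : Z) (d : nat) : list (list Z) :=
  match d with
  | O => [nil]
  | S d' => flat_map (fun c => map (cons c) (box m d'))
                     (zrange (- m) (Z.to_nat (2 * m)))
  end.

Definition Vbox (d k : nat) : list (list Z) := box (2 ^ Z.of_nat k)%Z d.

Definition lsum {A : Type} (f : A -> R) (l : list A) : R :=
  fold_right Rplus 0 (map f l).

Definition ind (p : Prop) : R :=
  if excluded_middle_informative p then 1 else 0.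

Definition count_in_box (d : nat) (A : list Z -> Prop) (k : nat) : R :=
  lsum (fun x => ind (A x)) (Vbox d k).

Definition log2 (x : R) : R := ln x / ln 2.

Definition is_limsup (u : nat -> R) (l : R) : Prop :=
  (forall eps, 0 < eps -> exists N, forall n, (N <= n)%nat -> u n < l + eps) /\
  (forall eps, 0 < eps -> forall N, exists n, (N <= n)%nat /\ l - eps < u n).

Definition upper_mink_dim_eq (d : nat) (A : list Z -> Prop) (D : R) : Prop :=
  is_limsup (fun n => log2 (count_in_box d A n) / INR n) D.

(* xi i is the increment xi_{i+1};  X_n = X_0 + xi_1 + ... + xi_n, X_0 = 0 *)
Definition walk {Omega : Type} (d : nat) (xi : nat -> Omega -> list Z)
    (n : nat) (w : Omega) : list Z :=
  fold_right vadd (zerov d) (map (fun i => xi i w) (seq 0 n)).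

Definition iid_increments {Omega : Type} (d : nat)
    (F : event Omega -> Prop) (P : event Omega -> R)
    (xi : nat -> Omega -> list Z) (mu : list Z -> R) : Prop :=
  (forall i w, length (xi i w) = d) /\
  (forall i x, F (fun w => xi i w = x)) /\
  (forall (n : nat) (xs : list (list Z)), length xs = n ->
     P (fun w => forall i, (i < n)%nat -> xi i w = nth i xs nil)
       = fold_right Rmult 1 (map mu xs)).

(* G is the Green function g(0,.) of the walk started at 0, and it is finite
   (transience): g(0,x) = sum_n P{X_n = x} converges, for every x in Z^d. *)
Definition green_function {Omega : Type} (d : nat) (P : event Omega -> R)
    (xi : nat -> Omega -> list Z) (G : list Z -> R) : Prop :=
  forall x, length x = d ->
    infinite_sum (fun n => P (fun w => walk d xi n w = x)) (G x).

(* sum_{x in Z^d \ {0}} g(0,x)/||x||^gamma < infinity (nonnegative terms: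
   bounded partial sums over the exhausting boxes V_k) *)
Definition green_sum_finite (d : nat) (G : list Z -> R) (gamma : R) : Prop :=
  exists M, forall k,
    lsum (fun x => ind (x <> zerov d) * (G x / Rpower (enorm x) gamma))
         (Vbox d k) <= M.

Definition crit_set (d : nat) (G : list Z -> R) (gamma : R) : Prop :=
  0 < gamma < INR d /\ green_sum_finite d G gamma.

Definition is_gamma_c (d : nat) (G : list Z -> R) (gc : R) : Prop :=
  ((forall gamma, ~ crit_set d G gamma) /\ gc = INR d) \/
  ((exists gamma, crit_set d G gamma) /\
   (forall gamma, crit_set d G gamma -> gc <= gamma) /\
   (forall b, (forall gamma, crit_set d G gamma -> b <= gamma) -> b <= gc)).

Definition range_of {Omega : Type} (d : nat) (xi : nat -> Omega -> list Z)
    (w : Omega) : list Z -> Prop :=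
  fun x => exists n, walk d xi n w = x.

(* Main.v *)
From Stdlib Require Import Reals ZArith List.
From Stdlib Require Import Lra Lia Classical ClassicalEpsilon
  FunctionalExtensionality PropExtensionality Cantor.
Require Import Defs.
Import ListNotations.
Open Scope R_scope.

(* A walk visits [x] with probability at least [G x / G 0], and two points [x]
   and [y] with probability at most [G x G (y - x) + G y G (x - y)].  Write
   [g n] for the sum of [G] over the box of side [2^(n+1)].  At a scale with
   [g (n + 1) <= K g n] the number of visited points in the box has mean at
   least [g n / G 0] and second moment at most a constant times [(g n)^2], so by
   the Paley-Zygmund inequality it is comparable to [g n] with probability
   bounded below.  Such scales with [g n >= 2^(gamma' n)] occur infinitely often
   for every [gamma' < gamma_c]: otherwise [g n] would outgrow the cardinality of
   the boxes.  Restarting the walk at later and later times turns the positive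
   probability into probability one, a translation by [X_S] costing a single
   scale.  The upper bound is Markov's inequality for the mean, at most [g n],
   and the Borel-Cantelli lemma. *)

(** * Finite sums *)

(** On the shell between consecutive boxes the norm is of order [2^n], so the series defining
    [gamma_c] behaves like the sum of [2^(- gamma n) * g n]: [gamma_c] is the upper exponential
    growth rate of [g n], and the count of visited points has to be compared with [g n]. The
    obstacle is the second moment: it involves differences [y - x] of points of one box, which range
    over the next box, so [g (n + 1)] enters and scales at which [g] jumps are useless. A jump by
    more than the volume factor [2^d], with a factor 2 to spare, cannot repeat forever because [G]
    is bounded by [G 0]; hence [K = 2 * 2^d].

    For the lower bound the walk is stopped at a finite time [T] chosen for each scale. The events
    are then predicates of finite blocks of increments, hence measurable and independent of earlier
    blocks, and hitting estimates become inequalities between finite sums. Expectations are never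
    formed: a pointwise inequality between finite combinations of indicators is turned into the same
    inequality between probabilities. *)

Lemma lsum_app {A : Type} (f : A -> R) l1 l2 :
  lsum f (l1 ++ l2) = lsum f l1 + lsum f l2.
Proof.
  unfold lsum; induction l1 as [|a l1 IH]; simpl; [lra|rewrite IH; lra].
Qed.

Lemma lsum_map {A B : Type} (f : B -> R) (g : A -> B) l :
  lsum f (map g l) = lsum (fun x => f (g x)) l.
Proof. unfold lsum; now rewrite map_map. Qed.

Lemma lsum_le {A : Type} (f g : A -> R) l :
  (forall x, In x l -> f x <= g x) -> lsum f l <= lsum g l.
Proof.
  unfold lsum; induction l as [|a l IH]; simpl; intros H; [lra|].
  apply Rplus_le_compat; auto.
Qed.

Lemma lsum_ext {A : Type} (f g : A -> R) l :
  (forall x, In x l -> f x = g x) -> lsum f l = lsum g l.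
Proof. intros H; apply Rle_antisym; apply lsum_le; intros x Hx; rewrite H; auto; lra. Qed.

Lemma lsum_plus {A : Type} (f g : A -> R) l :
  lsum (fun x => f x + g x) l = lsum f l + lsum g l.
Proof. unfold lsum; induction l as [|a l IH]; simpl; [lra|rewrite IH; lra]. Qed.

Lemma lsum_scal {A : Type} c (f : A -> R) l :
  lsum (fun x => c * f x) l = c * lsum f l.
Proof. unfold lsum; induction l as [|a l IH]; simpl; [lra|rewrite IH; lra]. Qed.

Lemma lsum_const {A : Type} c (l : list A) :
  lsum (fun _ => c) l = INR (length l) * c.
Proof.
  unfold lsum; induction l as [|a l IH]; [simpl; lra|].
  simpl length; rewrite S_INR; simpl; rewrite IH; lra.
Qed.

Lemma lsum_nonneg {A : Type} (f : A -> R) l :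
  (forall x, In x l -> 0 <= f x) -> 0 <= lsum f l.
Proof.
  intros H; replace 0 with (lsum (fun _ : A => 0) l).
  - now apply lsum_le.
  - rewrite lsum_const; lra.
Qed.

Lemma lsum_swap {A B : Type} (f : A -> B -> R) l1 l2 :
  lsum (fun x => lsum (f x) l2) l1 = lsum (fun y => lsum (fun x => f x y) l1) l2.
Proof.
  induction l1 as [|a l1 IH].
  - cbn. symmetry. change (lsum (fun _ : B => 0) l2 = 0).
    rewrite lsum_const; lra.
  - change (lsum (f a) l2 + lsum (fun x => lsum (f x) l2) l1 =
            lsum (fun y => f a y + lsum (fun x => f x y) l1) l2).
    now rewrite lsum_plus, IH.
Qed.

Lemma lsum_list_prod {A B : Type} (f : A * B -> R) l1 l2 :
  lsum f (list_prod l1 l2) = lsum (fun x => lsum (fun y => f (x, y)) l2) l1.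
Proof.
  induction l1 as [|a l1 IH]; [reflexivity|].
  simpl list_prod; rewrite lsum_app, lsum_map, IH; reflexivity.
Qed.

Lemma lsum_mul {A B : Type} (f : A -> R) (g : B -> R) l1 l2 :
  lsum f l1 * lsum g l2 = lsum (fun x => lsum (fun y => f x * g y) l2) l1.
Proof.
  rewrite (lsum_ext (fun x => lsum (fun y => f x * g y) l2) (fun x => lsum g l2 * f x)).
  - rewrite lsum_scal; lra.
  - intros x _; rewrite lsum_scal; lra.
Qed.

Lemma lsum_incl {A : Type} (f : A -> R) l1 l2 :
  NoDup l1 -> incl l1 l2 -> (forall x, In x l2 -> 0 <= f x) ->
  lsum f l1 <= lsum f l2.
Proof.
  revert l2; induction l1 as [|a l1 IH]; intros l2 Hnd Hi Hf.
  - now apply lsum_nonneg.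
  - inversion Hnd as [|? ? Hna Hnd']; subst.
    destruct (in_split a l2) as [u [v Huv]]; [apply Hi; now left|]; subst l2.
    assert (H : lsum f l1 <= lsum f (u ++ v)).
    { apply IH; auto.
      - intros x Hx. assert (Hx2 : In x (u ++ a :: v)) by (apply Hi; now right).
        apply in_app_or in Hx2; apply in_or_app.
        destruct Hx2 as [|[->|]]; tauto.
      - intros x Hx; apply Hf; apply in_app_or in Hx; apply in_or_app; simpl; tauto. }
    rewrite lsum_app in *. unfold lsum in *; simpl; lra.
Qed.

Lemma ind_true (p : Prop) : p -> ind p = 1.
Proof. intros H; unfold ind; destruct excluded_middle_informative; tauto. Qed.

Lemma ind_false (p : Prop) : ~ p -> ind p = 0.
Proof. intros H; unfold ind; destruct excluded_middle_informative; tauto. Qed.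

Lemma ind_bounds (p : Prop) : 0 <= ind p <= 1.
Proof. unfold ind; destruct excluded_middle_informative; lra. Qed.

Lemma ind_le (p q : Prop) : (p -> q) -> ind p <= ind q.
Proof.
  intros H; unfold ind; do 2 destruct excluded_middle_informative; try lra; tauto.
Qed.

Lemma ind_and (p q : Prop) : ind (p /\ q) = ind p * ind q.
Proof.
  unfold ind; repeat destruct excluded_middle_informative; try lra; tauto.
Qed.

(** The left side sums [t j * u l] over the triangle [j + l <= T], which lies in the square
    [j, l <= T]. *)
Lemma sum_convolution_le (t u : nat -> R) T :
  (forall n, 0 <= t n) -> (forall n, 0 <= u n) ->
  sum_f_R0 (fun k => sum_f_R0 (fun j => t j * u (k - j)%nat) k) T
  <= sum_f_R0 t T * sum_f_R0 u T.
Proof.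
  intros Ht Hu.
  assert (E : forall T, sum_f_R0 (fun k => sum_f_R0 (fun j => t j * u (k - j)%nat) k) T
     = sum_f_R0 (fun j => t j * sum_f_R0 u (T - j)) T).
  { clear T; induction T as [|T IH]; [reflexivity|].
    rewrite (tech5 (fun k => sum_f_R0 _ k)), IH, (tech5 (fun j => t j * sum_f_R0 u (S T - j))).
    rewrite tech5, <- Rplus_assoc, <- plus_sum, Nat.sub_diag; simpl (sum_f_R0 u 0).
    f_equal; apply sum_eq; intros i Hi.
    replace (S T - i)%nat with (S (T - i)) by lia; simpl; ring. }
  rewrite E, (Rmult_comm (sum_f_R0 t T)), scal_sum.
  apply sum_Rle; intros j Hj; apply Rmult_le_compat_l; [apply Ht|].
  destruct (Nat.eq_dec j 0) as [->|Hj0]; [rewrite Nat.sub_0_r; lra|].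
  rewrite (tech2 u (T - j) T) by lia.
  assert (0 <= sum_f_R0 (fun i => u (S (T - j) + i)%nat) (T - S (T - j))); [|lra].
  apply cond_pos_sum; intros; apply Hu.
Qed.

(** * Probability spaces *)

Lemma first_exists (Q : nat -> Prop) n : Q n ->
  exists m, (m <= n)%nat /\ Q m /\ forall i, (i < m)%nat -> ~ Q i.
Proof.
  induction n as [n IH] using lt_wf_ind; intros Hn.
  destruct (classic (exists i, (i < n)%nat /\ Q i)) as [[i [Hi Qi]]|Hno].
  - destruct (IH i Hi Qi) as [m [Hm Hq]]; exists m; split; auto; lia.
  - exists n; repeat split; auto; intros i Hi Qi; apply Hno; eauto.
Qed.

Section Probability.

Context {Omega : Type} (F : event Omega -> Prop) (P : event Omega -> R).
Context (HP : is_prob_space Omega F P).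

(** [F] and [P] are arbitrary functions of predicates, so equivalent events are made equal before
    rewriting under them. *)
Lemma event_ext (A B : event Omega) : (forall w, A w <-> B w) -> A = B.
Proof.
  intros H; apply functional_extensionality; intros w.
  apply propositional_extensionality, H.
Qed.

Lemma F_not A : F A -> F (fun w => ~ A w).
Proof. apply HP. Qed.

Lemma F_ex (A : nat -> event Omega) : (forall n, F (A n)) -> F (fun w => exists n, A n w).
Proof. apply HP. Qed.

Lemma F_const (p : Prop) : F (fun _ => p).
Proof.
  destruct (classic p) as [H|H].
  - replace (fun _ : Omega => p) with (fun _ : Omega => True); [apply HP|].
    apply event_ext; tauto.
  - replace (fun _ : Omega => p) with (fun _ : Omega => ~ True); [apply F_not, HP|].
    apply event_ext; tauto.
Qed.

Lemma F_all (A : nat -> event Omega) : (forall n, F (A n)) -> F (fun w => forall n, A n w).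
Proof.
  intros H. replace (fun w => forall n, A n w) with (fun w => ~ exists n, ~ A n w).
  - apply F_not, (F_ex (fun n w => ~ A n w)); intros n; now apply F_not.
  - apply event_ext; intros w; split.
    + intros Hn n; apply NNPP; intros Hc; apply Hn; now exists n.
    + intros Ha [n Hn]; auto.
Qed.

Lemma F_or A B : F A -> F B -> F (fun w => A w \/ B w).
Proof.
  intros HA HB.
  replace (fun w => A w \/ B w)
    with (fun w => exists n : nat, match n with O => A w | _ => B w end).
  - apply (F_ex (fun n w => match n with O => A w | _ => B w end)).
    intros [|n]; auto.
  - apply event_ext; intros w; split.
    + intros [[|n] H]; auto.
    + intros [H|H]; [now exists 0%nat|now exists 1%nat].
Qed.

Lemma F_and A B : F A -> F B -> F (fun w => A w /\ B w).
Proof.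
  intros HA HB. replace (fun w => A w /\ B w) with (fun w => ~ (~ A w \/ ~ B w)).
  - apply F_not, F_or; now apply F_not.
  - apply event_ext; intros w; tauto.
Qed.

Lemma P_nonneg A : F A -> 0 <= P A.
Proof. apply HP. Qed.

Lemma P_True : P (fun _ => True) = 1.
Proof. apply HP. Qed.

Lemma P_sigma (A : nat -> event Omega) : (forall n, F (A n)) ->
  (forall m n, m <> n -> forall w, A m w -> A n w -> False) ->
  infinite_sum (fun n => P (A n)) (P (fun w => exists n, A n w)).
Proof. apply HP. Qed.

(** Finite additivity has to be derived from the countable one by padding with empty events, which
    requires this first: the partial sums of a constant [p > 0] cannot converge to [p]. *)
Lemma P_False : P (fun _ => False) = 0.
Proof.
  pose proof (P_sigma (fun _ _ => False) (fun _ => F_const False)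
                (fun _ _ _ _ f _ => f)) as H.
  cbv beta in H.
  replace (fun w : Omega => exists _ : nat, False) with (fun w : Omega => False) in H
    by (apply event_ext; intros w; split; [tauto|intros [_ []]]).
  set (p := P (fun _ => False)) in *.
  assert (Hp : 0 <= p) by apply P_nonneg, F_const.
  destruct (Rle_lt_or_eq_dec 0 p Hp) as [Hlt|]; [exfalso|congruence].
  destruct (H p Hlt) as [N HN].
  specialize (HN (N + 2)%nat ltac:(lia)).
  rewrite sum_cte, !S_INR, plus_INR in HN; simpl in HN.
  unfold Rdist in HN; apply Rabs_def2 in HN.
  pose proof (pos_INR N); nra.
Qed.

Lemma P_or A B : F A -> F B -> (forall w, A w -> B w -> False) ->
  P (fun w => A w \/ B w) = P A + P B.
Proof.
  intros HA HB Hd.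
  set (C := fun n w => match n with 0 => A w | 1 => B w | _ => False end%nat).
  assert (H : infinite_sum (fun n => P (C n)) (P (fun w => exists n, C n w))).
  { apply P_sigma.
    - intros [|[|n]]; [exact HA|exact HB|exact (F_const False)].
    - intros [|[|m]] [|[|n]] Hmn w; simpl; try tauto; eauto; lia. }
  replace (fun w => A w \/ B w) with (fun w => exists n, C n w).
  - eapply uniqueness_sum; [exact H|].
    intros eps Heps; exists 1%nat; intros n Hn.
    replace (sum_f_R0 (fun n => P (C n)) n) with (P A + P B).
    + unfold Rdist; rewrite Rminus_diag, Rabs_R0; exact Heps.
    + induction Hn as [|n Hn IH]; [reflexivity|].
      rewrite tech5, <- IH. destruct n as [|n]; [lia|].
      change (P (C (S (S n)))) with (P (fun _ => False)); rewrite P_False; lra.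
  - apply event_ext; intros w; split.
    + intros [[|[|n]] Hn]; simpl in Hn; tauto.
    + intros [H1|H1]; [now exists 0%nat|now exists 1%nat].
Qed.

Lemma P_split A B : F A -> F B ->
  P A = P (fun w => A w /\ B w) + P (fun w => A w /\ ~ B w).
Proof.
  intros HA HB. rewrite <- P_or.
  - f_equal; apply event_ext; intros w; tauto.
  - now apply F_and.
  - apply F_and; auto; now apply F_not.
  - tauto.
Qed.

Lemma P_mono A B : F A -> F B -> (forall w, A w -> B w) -> P A <= P B.
Proof.
  intros HA HB H. rewrite (P_split B A) by auto.
  replace (fun w => B w /\ A w) with A by (apply event_ext; firstorder).
  assert (0 <= P (fun w => B w /\ ~ A w)); [|lra].
  apply P_nonneg, F_and; auto; now apply F_not.
Qed.

Lemma P_le_1 A : F A -> P A <= 1.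
Proof. intros H; rewrite <- P_True; apply P_mono; auto; apply F_const. Qed.

Lemma P_not A : F A -> P (fun w => ~ A w) = 1 - P A.
Proof.
  intros HA; rewrite <- P_True, (P_split (fun _ => True) A); auto using F_const.
  replace (fun w => True /\ A w) with A by (apply event_ext; tauto).
  replace (fun w => True /\ ~ A w) with (fun w => ~ A w) by (apply event_ext; tauto).
  lra.
Qed.

Lemma P_or_le A B : F A -> F B -> P (fun w => A w \/ B w) <= P A + P B.
Proof.
  intros HA HB. replace (fun w => A w \/ B w) with (fun w => A w \/ (B w /\ ~ A w))
    by (apply event_ext; intros w; destruct (classic (A w)); tauto).
  rewrite P_or; auto.
  - apply Rplus_le_compat_l, P_mono; auto; try tauto.
    apply F_and; auto; now apply F_not.
  - apply F_and; auto; now apply F_not.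
  - tauto.
Qed.

Lemma F_ex_le (A : nat -> event Omega) N : (forall n, F (A n)) ->
  F (fun w => exists n, (n <= N)%nat /\ A n w).
Proof.
  intros H; apply (F_ex (fun n w => (n <= N)%nat /\ A n w)).
  intros n; apply F_and; auto using F_const.
Qed.

Lemma ex_le_S (A : nat -> event Omega) N :
  (fun w => exists n, (n <= S N)%nat /\ A n w) =
  (fun w => (exists n, (n <= N)%nat /\ A n w) \/ A (S N) w).
Proof.
  apply event_ext; intros w; split.
  - intros [n [Hn Ha]]. destruct (Nat.eq_dec n (S N)) as [->|]; [now right|].
    left; exists n; split; auto; lia.
  - intros [[n [Hn Ha]]|Ha]; [exists n|exists (S N)]; split; auto; lia.
Qed.

Lemma ex_le_0 (A : nat -> event Omega) :
  (fun w => exists n, (n <= 0)%nat /\ A n w) = A 0%nat.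
Proof.
  apply event_ext; intros w; split.
  - intros [n [Hn Ha]]; now replace 0%nat with n by lia.
  - intros Ha; now exists 0%nat.
Qed.

Lemma P_ex_le_sum (A : nat -> event Omega) N : (forall n, F (A n)) ->
  P (fun w => exists n, (n <= N)%nat /\ A n w) <= sum_f_R0 (fun n => P (A n)) N.
Proof.
  intros HA; induction N as [|N IH].
  - rewrite ex_le_0; simpl; lra.
  - rewrite ex_le_S; simpl.
    eapply Rle_trans; [apply P_or_le; auto using F_ex_le|lra].
Qed.

Lemma P_ex_le_disjoint (A : nat -> event Omega) N : (forall n, F (A n)) ->
  (forall m n, m <> n -> forall w, A m w -> A n w -> False) ->
  P (fun w => exists n, (n <= N)%nat /\ A n w) = sum_f_R0 (fun n => P (A n)) N.
Proof.
  intros HA Hd; induction N as [|N IH].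
  - now rewrite ex_le_0.
  - rewrite ex_le_S; simpl. rewrite P_or, IH; auto using F_ex_le.
    intros w [n [Hn Ha]] Hb; apply (Hd n (S N)) with w; auto; lia.
Qed.

Lemma F_first (A : nat -> event Omega) n : (forall n, F (A n)) ->
  F (fun w => A n w /\ forall i, (i < n)%nat -> ~ A i w).
Proof.
  intros HA; apply F_and; auto.
  replace (fun w => forall i, (i < n)%nat -> ~ A i w)
    with (fun w => ~ exists i, (i < n)%nat /\ A i w).
  - apply F_not, (F_ex (fun i w => (i < n)%nat /\ A i w)).
    intros i; apply F_and; auto using F_const.
  - apply event_ext; intros w; split; firstorder.
Qed.

(** Continuity from below: keeping only the first index at which an event occurs makes the union
    disjoint without changing it or its finite sections. *)
Lemma P_ex_approx (A : nat -> event Omega) eps : (forall n, F (A n)) -> 0 < eps ->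
  exists N, P (fun w => exists n, A n w) - eps < P (fun w => exists n, (n <= N)%nat /\ A n w).
Proof.
  intros HA Heps.
  set (B := fun n w => A n w /\ forall i, (i < n)%nat -> ~ A i w).
  assert (HB : forall n, F (B n)) by (intros n; now apply F_first).
  assert (Hd : forall m n, m <> n -> forall w, B m w -> B n w -> False).
  { intros m n Hmn w [H1 H2] [H3 H4].
    destruct (Nat.lt_total m n) as [H|[H|H]]; [apply (H4 m)|lia|apply (H2 n)]; auto. }
  pose proof (P_sigma B HB Hd) as HS.
  destruct (HS eps Heps) as [N HN]; specialize (HN N (le_n N)).
  exists N.
  rewrite <- (P_ex_le_disjoint B N HB Hd) in HN.
  replace (fun w => exists n, A n w) with (fun w => exists n, B n w).
  replace (fun w => exists n, (n <= N)%nat /\ A n w)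
    with (fun w => exists n, (n <= N)%nat /\ B n w).
  - unfold Rdist in HN; apply Rabs_def2 in HN; lra.
  - apply event_ext; intros w; split.
    + intros [n [Hn [H _]]]; eauto.
    + intros [n [Hn H]].
      destruct (first_exists (fun n => A n w) n H) as [m [Hm Hq]].
      exists m; split; [lia|exact Hq].
  - apply event_ext; intros w; split.
    + intros [n [H _]]; eauto.
    + intros [n H].
      destruct (first_exists (fun n => A n w) n H) as [m [Hm Hq]]; exists m; exact Hq.
Qed.

Lemma P_ex_bound (A : nat -> event Omega) c : (forall n, F (A n)) ->
  (forall N, P (fun w => exists n, (n <= N)%nat /\ A n w) <= c) ->
  P (fun w => exists n, A n w) <= c.
Proof.
  intros HA H; apply Rnot_lt_le; intros Hc.
  destruct (P_ex_approx A (P (fun w => exists n, A n w) - c) HA ltac:(lra)) as [N HN].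
  specialize (H N); lra.
Qed.

(* Splitting [B] successively along the events of the list reduces to the
   case where the linear combination of indicators is constant. *)
Lemma P_linear_nonneg_on (l : list (R * event Omega)) :
  (forall ca, In ca l -> F (snd ca)) ->
  forall (c : R) (B : event Omega), F B ->
  (forall w, B w -> 0 <= c + lsum (fun ca => fst ca * ind (snd ca w)) l) ->
  0 <= c * P B + lsum (fun ca => fst ca * P (fun w => B w /\ snd ca w)) l.
Proof.
  induction l as [|[a A] l IH]; intros HF c B HB Hpos.
  - cbn. rewrite Rplus_0_r.
    destruct (classic (exists w, B w)) as [[w Hw]|Hno].
    + specialize (Hpos w Hw); cbn in Hpos.
      apply Rmult_le_pos; [lra|now apply P_nonneg].
    + replace B with (fun _ : Omega => False); [rewrite P_False; lra|].
      apply event_ext; firstorder.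
  - assert (HA : F A) by (apply (HF (a, A)); now left).
    assert (HF' : forall ca, In ca l -> F (snd ca)) by (intros; apply HF; now right).
    assert (HBA : F (fun w => B w /\ A w)) by now apply F_and.
    assert (HBnA : F (fun w => B w /\ ~ A w)) by (apply F_and; auto; now apply F_not).
    assert (H1 := IH HF' (c + a) _ HBA).
    assert (H2 := IH HF' c _ HBnA).
    unfold lsum in Hpos; simpl in Hpos; fold (lsum (A := R * event Omega)) in Hpos.
    assert (H1' := H1 ltac:(intros w [Hb Ha]; specialize (Hpos w Hb);
       rewrite (ind_true (A w)) in Hpos by auto; unfold lsum; lra)).
    assert (H2' := H2 ltac:(intros w [Hb Ha]; specialize (Hpos w Hb);
       rewrite (ind_false (A w)) in Hpos by auto; unfold lsum; lra)).
    change (0 <= c * P B + (a * P (fun w => B w /\ A w) +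
       lsum (fun ca => fst ca * P (fun w => B w /\ snd ca w)) l)).
    rewrite (P_split B A HB HA).
    rewrite (lsum_ext (fun ca => fst ca * P (fun w => B w /\ snd ca w))
      (fun ca => fst ca * P (fun w => (B w /\ A w) /\ snd ca w)
               + fst ca * P (fun w => (B w /\ ~ A w) /\ snd ca w))).
    + rewrite lsum_plus; lra.
    + intros [e E] HE; simpl.
      assert (FE : F E) by (apply (HF' _ HE)).
      rewrite (P_split (fun w => B w /\ E w) A) by auto using F_and.
      replace (fun w => (B w /\ E w) /\ A w) with (fun w => (B w /\ A w) /\ E w)
        by (apply event_ext; tauto).
      replace (fun w => (B w /\ E w) /\ ~ A w) with (fun w => (B w /\ ~ A w) /\ E w)
        by (apply event_ext; tauto).
      ring.
Qed.

(** Positivity of the expectation of a simple function, stated without an integral. Both the Markov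
    and the Paley-Zygmund inequalities are instances for a suitable list. *)
Lemma P_linear_nonneg (l : list (R * event Omega)) (c : R) :
  (forall ca, In ca l -> F (snd ca)) ->
  (forall w, 0 <= c + lsum (fun ca => fst ca * ind (snd ca w)) l) ->
  0 <= c + lsum (fun ca => fst ca * P (snd ca)) l.
Proof.
  intros HF Hpos.
  assert (H := P_linear_nonneg_on l HF c (fun _ => True) (F_const True) (fun w _ => Hpos w)).
  rewrite P_True, Rmult_1_r in H.
  rewrite (lsum_ext _ (fun ca => fst ca * P (fun w => True /\ snd ca w))); [exact H|].
  intros [e E] _; simpl; do 2 f_equal; apply event_ext; tauto.
Qed.

(** A measurable witness is part of the definition, so that [Q], for instance a statement about a
    limsup, need not itself be shown to lie in [F]. *)
Definition almost_surely (Q : Omega -> Prop) : Prop :=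
  exists A : event Omega, F A /\ P A = 1 /\ forall w, A w -> Q w.

Lemma almost_surely_impl (Q Q' : Omega -> Prop) :
  (forall w, Q w -> Q' w) -> almost_surely Q -> almost_surely Q'.
Proof. intros H [A [HA [H1 H2]]]; exists A; auto. Qed.

Lemma almost_surely_true (Q : Omega -> Prop) : (forall w, Q w) -> almost_surely Q.
Proof. intros H; exists (fun _ => True); auto using F_const, P_True. Qed.

Lemma almost_surely_all (Q : nat -> Omega -> Prop) :
  (forall k, almost_surely (Q k)) -> almost_surely (fun w => forall k, Q k w).
Proof.
  intros H. apply choice in H. destruct H as [A HA].
  assert (HF : forall n, F (A n)) by apply HA.
  exists (fun w => forall n, A n w); split; [now apply F_all|split].
  - assert (HN : P (fun w => exists n, ~ A n w) <= 0).
    { apply (P_ex_bound (fun n w => ~ A n w)); [intros n; now apply F_not|].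
      intros N; eapply Rle_trans;
        [apply (P_ex_le_sum (fun n w => ~ A n w)); intros n; now apply F_not|].
      right; apply sum_eq_R0; intros n _; rewrite P_not; auto.
      destruct (HA n) as [_ [-> _]]; lra. }
    assert (HF2 : F (fun w => exists n, ~ A n w))
      by (apply (F_ex (fun n w => ~ A n w)); intros n; now apply F_not).
    replace (fun w => forall n, A n w) with (fun w => ~ exists n, ~ A n w).
    + rewrite P_not by auto. pose proof (P_nonneg _ HF2); lra.
    + apply event_ext; intros w; split.
      * intros Hn n; apply NNPP; intros Hc; apply Hn; now exists n.
      * intros Ha [n Hn]; auto.
  - intros w Hw k; apply HA, Hw.
Qed.

Lemma almost_surely_and (Q Q' : Omega -> Prop) :
  almost_surely Q -> almost_surely Q' -> almost_surely (fun w => Q w /\ Q' w).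
Proof.
  intros H H'.
  apply (almost_surely_impl (fun w => forall k : nat, match k with O => Q w | _ => Q' w end)).
  - intros w Hw; split; [exact (Hw 0%nat)|exact (Hw 1%nat)].
  - apply (almost_surely_all (fun k w => match k with O => Q w | _ => Q' w end)).
    intros [|k]; auto.
Qed.

Lemma almost_surely_lower (A : event Omega) :
  F A -> (forall eps, 0 < eps -> 1 - eps <= P A) -> almost_surely A.
Proof.
  intros HA H; exists A; split; [auto|split; [|auto]].
  apply Rle_antisym; [now apply P_le_1|].
  apply Rnot_lt_le; intros Hc; specialize (H ((1 - P A) / 2)); lra.
Qed.

(** The geometric majorant makes the tail explicit: some [B n] with [n >= N] occurs with probability
    at most [C / (1 - r) * r ^ N]. *)
Lemma borel_cantelli (B : nat -> event Omega) (C r : R) :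
  0 <= r < 1 -> (forall n, F (B n)) -> (forall n, P (B n) <= C * r ^ n) ->
  almost_surely (fun w => exists N, forall n, (N <= n)%nat -> ~ B n w).
Proof.
  intros Hr HB HC.
  assert (C0 : 0 <= C)
    by (pose proof (HC 0%nat) as H; pose proof (P_nonneg _ (HB 0%nat)); simpl in H; lra).
  assert (HF : forall N n, F (fun w => (N <= n)%nat /\ B n w))
    by (intros; apply F_and; auto using F_const).
  assert (HFE : forall N, F (fun w => exists n, (N <= n)%nat /\ B n w))
    by (intros N; apply (F_ex (fun n w => (N <= n)%nat /\ B n w)); auto).
  assert (HT : forall N, P (fun w => exists n, (N <= n)%nat /\ B n w) <= C / (1 - r) * r ^ N).
  { intros N.
    replace (fun w => exists n, (N <= n)%nat /\ B n w) with (fun w => exists n, B (N + n)%nat w).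
    - apply (P_ex_bound (fun n => B (N + n)%nat)); auto.
      intros M; eapply Rle_trans; [apply (P_ex_le_sum (fun n => B (N + n)%nat)); auto|].
      apply Rle_trans with (sum_f_R0 (fun n => r ^ n * (C * r ^ N)) M).
      + apply sum_Rle; intros n _; eapply Rle_trans; [apply HC|].
        rewrite pow_add; right; ring.
      + rewrite <- scal_sum, tech3 by lra.
        replace (C / (1 - r) * r ^ N) with (C * r ^ N * (1 / (1 - r))) by (field; lra).
        apply Rmult_le_compat_l; [apply Rmult_le_pos; auto; apply pow_le; lra|].
        apply Rmult_le_compat_r; [left; apply Rinv_0_lt_compat; lra|].
        pose proof (pow_le r (S M)); lra.
    - apply event_ext; intros w; split.
      + intros [n Hn]; exists (N + n)%nat; split; auto; lia.
      + intros [n [Hn Hb]]; exists (n - N)%nat; now replace (N + (n - N))%nat with n by lia. }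
  apply (almost_surely_impl (fun w => exists N, ~ exists n, (N <= n)%nat /\ B n w)).
  { intros w [N HN]; exists N; intros n Hn Hb; apply HN; eauto. }
  assert (HFN : forall N, F (fun w => ~ exists n, (N <= n)%nat /\ B n w))
    by (intros N; now apply F_not).
  apply almost_surely_lower.
  - now apply (F_ex (fun N w => ~ exists n, (N <= n)%nat /\ B n w)).
  - intros eps Heps.
    (* The added 1 keeps the divisor positive when [C] is 0. *)
    assert (Hp : 0 < eps / (C / (1 - r) + 1)).
    { apply Rdiv_lt_0_compat; auto.
      assert (0 <= C / (1 - r)); [|lra].
      apply Rmult_le_pos; auto; left; apply Rinv_0_lt_compat; lra. }
    destruct (pow_lt_1_zero r ltac:(rewrite Rabs_pos_eq; lra) _ Hp) as [N HN].
    specialize (HN N (le_n N)). rewrite Rabs_pos_eq in HN by (apply pow_le; lra).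
    apply Rle_trans with (P (fun w => ~ exists n, (N <= n)%nat /\ B n w)).
    + rewrite P_not by auto. specialize (HT N).
      set (D := C / (1 - r)) in *.
      assert (HD : 0 <= D)
        by (apply Rmult_le_pos; auto; left; apply Rinv_0_lt_compat; lra).
      assert (D * r ^ N <= D * (eps / (D + 1))) by (apply Rmult_le_compat_l; lra).
      assert (D * (eps / (D + 1)) <= eps).
      { replace (D * (eps / (D + 1))) with (eps - eps / (D + 1)) by (field; lra). lra. }
      lra.
    + apply P_mono; auto.
      * now apply (F_ex (fun N w => ~ exists n, (N <= n)%nat /\ B n w)).
      * intros w Hw; now exists N.
Qed.

End Probability.

(** * The lattice *)

Definition vsub (u v : list Z) : list Z :=
  map (fun p => (fst p - snd p)%Z) (combine u v).

Lemma vadd_length d u v : length u = d -> length v = d -> length (vadd u v) = d.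
Proof. intros H1 H2; unfold vadd; rewrite length_map, length_combine; lia. Qed.

Lemma vsub_length d u v : length u = d -> length v = d -> length (vsub u v) = d.
Proof. intros H1 H2; unfold vsub; rewrite length_map, length_combine; lia. Qed.

Lemma zerov_length d : length (zerov d) = d.
Proof. apply repeat_length. Qed.

Lemma vadd_assoc u v w : vadd u (vadd v w) = vadd (vadd u v) w.
Proof.
  unfold vadd; revert v w; induction u as [|a u IH]; intros [|b v] [|c w]; simpl; auto.
  f_equal; [lia|apply IH].
Qed.

Lemma vadd_zerov_l v : vadd (zerov (length v)) v = v.
Proof.
  unfold vadd, zerov; induction v as [|a v IH]; simpl; auto; now rewrite IH.
Qed.

Lemma vsub_diag v : vsub v v = zerov (length v).
Proof.
  unfold vsub, zerov; induction v as [|a v IH]; simpl; auto; rewrite IH.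
  f_equal; lia.
Qed.

Lemma vadd_eq_iff u v w : length u = length w -> length v = length w ->
  (vadd u v = w <-> v = vsub w u).
Proof.
  unfold vadd, vsub; revert v w; induction u as [|a u IH]; intros [|b v] [|c w];
    simpl; intros H1 H2; try discriminate; [tauto|].
  injection H1 as H1; injection H2 as H2.
  specialize (IH v w H1 H2); split; intros E; injection E as E1 E2;
    f_equal; try lia; now apply IH.
Qed.

Lemma In_zrange a k z : In z (zrange a k) <-> (a <= z < a + Z.of_nat k)%Z.
Proof.
  unfold zrange; rewrite in_map_iff; split.
  - intros [i [<- Hi]]; apply in_seq in Hi; lia.
  - intros H; exists (Z.to_nat (z - a)); split; [lia|apply in_seq; lia].
Qed.

Lemma NoDup_zrange a k : NoDup (zrange a k).
Proof.
  unfold zrange; apply NoDup_map_NoDup_ForallPairs; [|apply seq_NoDup].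
  intros i j _ _ H; cbv beta in H; lia.
Qed.

Lemma In_box m d x : (0 <= m)%Z ->
  (In x (box m d) <-> length x = d /\ forall z, In z x -> (- m <= z < m)%Z).
Proof.
  intros Hm; revert x; induction d as [|d IH]; intros x; cbn [box].
  - split.
    + intros [<-|[]]; split; [reflexivity|intros z []].
    + intros [H _]; left; destruct x; [reflexivity|discriminate].
  - rewrite in_flat_map; split.
    + intros [c [Hc Hx]]; apply In_zrange in Hc; apply in_map_iff in Hx.
      destruct Hx as [y [<- Hy]]; apply IH in Hy; destruct Hy as [H1 H2].
      split; [simpl; lia|]. intros z [<-|Hz]; [lia|auto].
    + intros [H1 H2]; destruct x as [|c y]; [discriminate|].
      exists c; split.
      * apply In_zrange. specialize (H2 c (or_introl eq_refl)); lia.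
      * apply in_map, IH; split; [simpl in H1; lia|].
        intros z Hz; apply H2; now right.
Qed.

Lemma NoDup_box m d : NoDup (box m d).
Proof.
  induction d as [|d IH]; cbn [box]; [repeat constructor; easy|].
  generalize (NoDup_zrange (- m) (Z.to_nat (2 * m))).
  generalize (zrange (- m) (Z.to_nat (2 * m))); intros l Hl.
  induction Hl as [|c l Hc Hl IHl]; simpl; [constructor|].
  apply NoDup_app; auto.
  - apply NoDup_map_NoDup_ForallPairs; auto; intros u v _ _ H; now injection H.
  - intros x Hx Hx'; apply in_map_iff in Hx; destruct Hx as [u [<- _]].
    apply in_flat_map in Hx'; destruct Hx' as [c' [Hc' Hx']].
    apply in_map_iff in Hx'; destruct Hx' as [v [Hv _]].
    injection Hv as -> _; contradiction.
Qed.

Lemma length_box m d : length (box m d) = (Z.to_nat (2 * m) ^ d)%nat.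
Proof.
  induction d as [|d IH]; [reflexivity|]; simpl box.
  rewrite flat_map_constant_length with (c := length (box m d)).
  - unfold zrange; rewrite length_map, length_seq, IH; reflexivity.
  - intros c _; apply length_map.
Qed.

Lemma In_Vbox d k x :
  In x (Vbox d k) <->
  length x = d /\ forall z, In z x -> (- 2 ^ Z.of_nat k <= z < 2 ^ Z.of_nat k)%Z.
Proof. apply In_box; lia. Qed.

Lemma Vbox_length d x n : In x (Vbox d n) -> length x = d.
Proof. intros H; now apply In_Vbox in H. Qed.

Lemma NoDup_Vbox d k : NoDup (Vbox d k).
Proof. apply NoDup_box. Qed.

Lemma pow2_le_mono j k : (j <= k)%nat -> (2 ^ Z.of_nat j <= 2 ^ Z.of_nat k)%Z.
Proof. intros H; apply Z.pow_le_mono_r; lia. Qed.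

Lemma Vbox_mono d j k : (j <= k)%nat -> incl (Vbox d j) (Vbox d k).
Proof.
  intros Hjk x Hx; apply In_Vbox in Hx; apply In_Vbox.
  destruct Hx as [H1 H2]; split; auto; intros z Hz.
  specialize (H2 z Hz); pose proof (pow2_le_mono j k Hjk); lia.
Qed.

Lemma Vbox_exhaust d x : length x = d -> exists k, In x (Vbox d k).
Proof.
  intros H.
  assert (E : exists k, forall z, In z x -> (- 2 ^ Z.of_nat k <= z < 2 ^ Z.of_nat k)%Z).
  { clear H; induction x as [|a x [k IH]]; [exists 0%nat; intros z []|].
    exists (Nat.max k (Z.abs_nat a)); intros z [<-|Hz].
    - pose proof (Z.pow_gt_lin_r 2 (Z.of_nat (Z.abs_nat a)) ltac:(lia) ltac:(lia)).
      pose proof (pow2_le_mono (Z.abs_nat a) (Nat.max k (Z.abs_nat a)) ltac:(lia)); lia.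
    - specialize (IH z Hz).
      pose proof (pow2_le_mono k (Nat.max k (Z.abs_nat a)) ltac:(lia)); lia. }
  destruct E as [k Hk]; exists k; apply In_Vbox; auto.
Qed.

Lemma pow2_S k : (2 ^ Z.of_nat (S k) = 2 * 2 ^ Z.of_nat k)%Z.
Proof. rewrite Nat2Z.inj_succ, Z.pow_succ_r; lia. Qed.

Lemma In_vadd a b u v :
  (forall z, In z u -> (- a <= z < a)%Z) -> (forall z, In z v -> (- b <= z < b)%Z) ->
  forall z, In z (vadd u v) -> (- (a + b) <= z < a + b)%Z.
Proof.
  intros Hu Hv z Hz; unfold vadd in Hz; apply in_map_iff in Hz.
  destruct Hz as [[s t] [<- Hst]].
  pose proof (in_combine_l _ _ _ _ Hst) as H1; apply in_combine_r in Hst.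
  specialize (Hu s H1); specialize (Hv t Hst); cbn [fst snd]; lia.
Qed.

Lemma Vbox_vadd d k u v :
  In u (Vbox d k) -> In v (Vbox d k) -> In (vadd u v) (Vbox d (S k)).
Proof.
  intros Hu Hv; apply In_Vbox in Hu, Hv; apply In_Vbox.
  destruct Hu as [Lu Hu], Hv as [Lv Hv]; split; [now apply vadd_length|].
  intros z Hz; rewrite pow2_S.
  pose proof (In_vadd _ _ _ _ Hu Hv z Hz); lia.
Qed.

(** The boxes are half-open and not symmetric, but a difference of two coordinates lies strictly
    between [- 2^(k+1)] and [2^(k+1)]. *)
Lemma Vbox_vsub d k u v :
  In u (Vbox d k) -> In v (Vbox d k) -> In (vsub u v) (Vbox d (S k)).
Proof.
  intros Hu Hv; apply In_Vbox in Hu, Hv; apply In_Vbox.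
  destruct Hu as [Lu Hu], Hv as [Lv Hv]; split; [now apply vsub_length|].
  intros z Hz; rewrite pow2_S; unfold vsub in Hz; apply in_map_iff in Hz.
  destruct Hz as [[s t] [<- Hst]].
  pose proof (in_combine_l _ _ _ _ Hst) as H1; apply in_combine_r in Hst.
  specialize (Hu s H1); specialize (Hv t Hst); cbn [fst snd]; lia.
Qed.

Lemma zerov_Vbox d k : In (zerov d) (Vbox d k).
Proof.
  apply In_Vbox; split; [apply zerov_length|].
  intros z Hz; apply repeat_spec in Hz; subst.
  pose proof (Z.pow_pos_nonneg 2 (Z.of_nat k)); lia.
Qed.

(** * Independence of the past and the future of the increments *)

(** A code for a list is its length together with nested Cantor pairs; the length drives the
    recursion. Different codes may give the same list. *)
Fixpoint decode_list {A : Type} (f : nat -> A) (len n : nat) : list A :=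
  match len with
  | O => []
  | S len' => let (a, b) := Cantor.of_nat n in f a :: decode_list f len' b
  end.

Definition enum_list {A : Type} (f : nat -> A) (n : nat) : list A :=
  let (len, k) := Cantor.of_nat n in decode_list f len k.

Lemma enum_list_surj {A : Type} (f : nat -> A) :
  (forall a, exists n, f n = a) -> forall l, exists n, enum_list f n = l.
Proof.
  intros Hf l.
  assert (H : exists k, decode_list f (length l) k = l).
  { induction l as [|a l [k IH]]; [now exists 0%nat|].
    destruct (Hf a) as [n Hn]; exists (Cantor.to_nat (n, k)).
    cbn [length decode_list]; rewrite Cantor.cancel_of_to, Hn, IH; reflexivity. }
  destruct H as [k Hk]; exists (Cantor.to_nat (length l, k)).
  unfold enum_list; now rewrite Cantor.cancel_of_to.
Qed.

Definition enum_Z (n : nat) : Z :=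
  let (a, b) := Cantor.of_nat n in (Z.of_nat a - Z.of_nat b)%Z.

Lemma enum_Z_surj z : exists n, enum_Z n = z.
Proof.
  exists (Cantor.to_nat (Z.to_nat z, Z.to_nat (- z))).
  unfold enum_Z; rewrite Cantor.cancel_of_to; lia.
Qed.

Lemma enum_lists_surj (l : list (list Z)) : exists n, enum_list (enum_list enum_Z) n = l.
Proof. revert l; apply enum_list_surj, enum_list_surj, enum_Z_surj. Qed.

(** * Random variables with values in a countable set *)

Section Countable.

Context {Omega B : Type} (F : event Omega -> Prop) (P : event Omega -> R).
Context (HP : is_prob_space Omega F P).
Context (e : nat -> B) (He : forall b, exists n, e n = b).

Lemma F_countable (Y : Omega -> B) (a : B -> Prop) :
  (forall y, F (fun w => Y w = y)) -> F (fun w => a (Y w)).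
Proof.
  intros HY. replace (fun w => a (Y w)) with (fun w => exists n, Y w = e n /\ a (e n)).
  - apply (F_ex F P HP (fun n w => Y w = e n /\ a (e n))).
    intros n; apply (F_and F P HP); auto; apply (F_const F P HP).
  - apply event_ext; intros w; split.
    + now intros [n [-> H]].
    + intros H; destruct (He (Y w)) as [n Hn]; exists n; now rewrite Hn.
Qed.

(* [e] need not be injective: only the first index of each value counts. *)
Lemma P_countable_sum (D : event Omega) (Y : Omega -> B) (a : B -> Prop) :
  F D -> (forall y, F (fun w => Y w = y)) ->
  infinite_sum
    (fun n => ind ((forall i, (i < n)%nat -> e i <> e n) /\ a (e n)) *
              P (fun w => D w /\ Y w = e n))
    (P (fun w => D w /\ a (Y w))).
Proof.
  intros HD HY.
  set (E := fun n w => ((forall i, (i < n)%nat -> e i <> e n) /\ a (e n)) /\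
                       (D w /\ Y w = e n)).
  assert (HE : forall n, F (E n)).
  { intros n; apply (F_and F P HP); [apply (F_const F P HP)|].
    now apply (F_and F P HP). }
  assert (H : infinite_sum (fun n => P (E n)) (P (fun w => exists n, E n w))).
  { apply (P_sigma F P HP); auto.
    intros m n Hmn w [[H1 _] [_ H2]] [[H3 _] [_ H4]].
    assert (e m = e n) by congruence.
    destruct (Nat.lt_total m n) as [L|[L|L]]; [apply (H3 m)|lia|apply (H1 n)]; auto. }
  replace (fun n => ind ((forall i, (i < n)%nat -> e i <> e n) /\ a (e n)) *
              P (fun w => D w /\ Y w = e n)) with (fun n => P (E n)).
  - replace (fun w => D w /\ a (Y w)) with (fun w => exists n, E n w); auto.
    apply event_ext; intros w; split.
    + intros [n [[_ Ha] [Hd Hy]]]; now rewrite Hy.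
    + intros [Hd Ha]. destruct (He (Y w)) as [n Hn].
      destruct (first_exists (fun n => e n = Y w) n Hn) as [m [_ [Hm Hmin]]].
      exists m; split; [split|split]; auto; try congruence.
      intros i Hi; rewrite Hm; now apply Hmin.
  - apply functional_extensionality; intros n.
    destruct (classic ((forall i, (i < n)%nat -> e i <> e n) /\ a (e n))) as [Hc|Hc].
    + rewrite (ind_true _ Hc), Rmult_1_l; f_equal; apply event_ext; unfold E; tauto.
    + rewrite (ind_false _ Hc), Rmult_0_l, <- (P_False F P HP); f_equal.
      apply event_ext; unfold E; tauto.
Qed.

(** Proportionality on points passes to arbitrary subsets of a countable set by summation. This
    takes the place of a monotone class argument in going from cylinders to general events. *)
Lemma P_countable_proportional (D D' : event Omega) (Y Y' : Omega -> B) (a : B -> Prop) c :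
  F D -> F D' -> (forall y, F (fun w => Y w = y)) -> (forall y, F (fun w => Y' w = y)) ->
  (forall y, P (fun w => D w /\ Y w = y) = c * P (fun w => D' w /\ Y' w = y)) ->
  P (fun w => D w /\ a (Y w)) = c * P (fun w => D' w /\ a (Y' w)).
Proof.
  intros HD HD' HY HY' Hc.
  apply (uniqueness_sum _ _ _ (P_countable_sum D Y a HD HY)).
  assert (H := P_countable_sum D' Y' a HD' HY').
  set (u := fun n => ind ((forall i, (i < n)%nat -> e i <> e n) /\ a (e n)) *
                     P (fun w => D' w /\ Y' w = e n)) in *.
  apply (Un_cv_ext (fun N => c * sum_f_R0 u N)).
  - intros N; rewrite scal_sum; apply sum_eq; intros i _; rewrite Hc; unfold u; ring.
  - apply (CV_mult (fun _ => c)); [|exact H].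
    intros eps Heps; exists 0%nat; intros; unfold Rdist; rewrite Rminus_diag, Rabs_R0; auto.
Qed.

End Countable.

Section Walk.

Context {Omega : Type} (d : nat) (F : event Omega -> Prop) (P : event Omega -> R).
Context (xi : nat -> Omega -> list Z) (mu : list Z -> R).
Context (HP : is_prob_space Omega F P) (Hxi : iid_increments d F P xi mu).

(** Events are written as predicates of such a block, so that measurability and independence are
    proved once, for all predicates. *)
Definition increments (s m : nat) (w : Omega) : list (list Z) :=
  map (fun i => xi i w) (seq s m).

Definition vsum (xs : list (list Z)) : list Z := fold_right vadd (zerov d) xs.

Lemma increments_length s m w : length (increments s m w) = m.
Proof. unfold increments; now rewrite length_map, length_seq. Qed.

Lemma increments_app s m n w :
  increments s (m + n) w = increments s m w ++ increments (s + m) n w.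
Proof. unfold increments; now rewrite seq_app, map_app. Qed.

Lemma F_increments_eq s m xs : F (fun w => increments s m w = xs).
Proof.
  revert s xs; induction m as [|m IH]; intros s xs; [exact (F_const F P HP ([] = xs))|].
  destruct xs as [|x xs].
  - replace (fun w => increments s (S m) w = []) with (fun _ : Omega => False);
      [apply (F_const F P HP)|apply event_ext; intros w; split; [tauto|discriminate]].
  - replace (fun w => increments s (S m) w = x :: xs)
      with (fun w => xi s w = x /\ increments (S s) m w = xs).
    + apply (F_and F P HP); [apply Hxi|apply IH].
    + apply event_ext; intros w; unfold increments; simpl; split.
      * now intros [-> ->].
      * intros H; injection H; auto.
Qed.

Lemma F_increments s m (a : list (list Z) -> Prop) : F (fun w => a (increments s m w)).
Proof.
  apply (F_countable F P HP (enum_list (enum_list enum_Z)) enum_lists_surj (increments s m)).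
  intros; apply F_increments_eq.
Qed.

Lemma P_increments_eq n xs : length xs = n ->
  P (fun w => increments 0 n w = xs) = fold_right Rmult 1 (map mu xs).
Proof.
  intros Hn; rewrite <- (proj2 (proj2 Hxi) n xs Hn); f_equal.
  apply event_ext; intros w; split.
  - intros <- i Hi; unfold increments.
    rewrite nth_indep with (d' := xi 0%nat w) by (rewrite length_map, length_seq; lia).
    rewrite (map_nth (fun i => xi i w)), seq_nth; auto.
  - intros H; apply nth_ext with (d := []) (d' := []);
      rewrite increments_length; auto.
    intros i Hi; rewrite <- (H i Hi); unfold increments.
    rewrite nth_indep with (d' := xi 0%nat w) by (rewrite length_map, length_seq; lia).
    rewrite (map_nth (fun i => xi i w)), seq_nth; auto.
Qed.

(** Independence and stationarity at once: the product formula depends only on the values, so the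
    block starting at [m] has the law of the one starting at 0. Proportionality is used twice, over
    the future with the past fixed to a point, then over the past with the future event fixed. *)
Lemma P_increments_indep m t (a b : list (list Z) -> Prop) :
  P (fun w => a (increments 0 m w) /\ b (increments m t w)) =
  P (fun w => a (increments 0 m w)) * P (fun w => b (increments 0 t w)).
Proof.
  assert (Hcyl : forall xs,
    P (fun w => increments 0 m w = xs /\ b (increments m t w)) =
    P (fun w => increments 0 m w = xs) * P (fun w => b (increments 0 t w))).
  { intros xs.
    assert (H := P_countable_proportional F P HP _ enum_lists_surj
      (fun w => increments 0 m w = xs) (fun _ => True) (increments m t) (increments 0 t)
      b (P (fun w => increments 0 m w = xs))).
    cbv beta in H; rewrite H.
    - do 2 f_equal; apply event_ext; tauto.
    - apply F_increments_eq.
    - apply (F_const F P HP).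
    - apply F_increments_eq.
    - apply F_increments_eq.
    - intros ys. replace (fun w => True /\ increments 0 t w = ys)
        with (fun w => increments 0 t w = ys) by (apply event_ext; tauto).
      (* A list of the wrong length is never attained and both sides vanish; otherwise [xs ++ ys]
         gives a cylinder of length [m + t] whose probability factors. *)
      destruct (Nat.eq_dec (length xs) m) as [Hm|Hm];
        [destruct (Nat.eq_dec (length ys) t) as [Ht|Ht]|].
      + rewrite (P_increments_eq m xs), (P_increments_eq t ys) by auto.
        transitivity (fold_right Rmult 1 (map mu (xs ++ ys))).
        * rewrite <- (P_increments_eq (m + t) (xs ++ ys)) by (rewrite length_app; lia).
          f_equal; apply event_ext; intros w; rewrite increments_app, Nat.add_0_l; split.
          -- now intros [-> ->].
          -- intros E; split.
             ++ apply (f_equal (firstn m)) in E.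
                rewrite !firstn_app, increments_length, Hm, Nat.sub_diag, !app_nil_r in E.
                rewrite !firstn_all2 in E by (rewrite ?increments_length; lia); exact E.
             ++ apply (f_equal (skipn m)) in E.
                rewrite !skipn_app, increments_length, Hm, Nat.sub_diag in E.
                rewrite !(skipn_all2 (n := m)) in E by (rewrite ?increments_length; lia).
                exact E.
        * clear; induction xs as [|x xs IH]; simpl; [ring|rewrite IH; ring].
      + replace (fun w => increments 0 t w = ys) with (fun _ : Omega => False).
        * rewrite (P_False F P HP), Rmult_0_r, <- (P_False F P HP); f_equal.
          apply event_ext; intros w; split; [|tauto]; intros [_ E].
          apply Ht; rewrite <- E; apply increments_length.
        * apply event_ext; intros w; split; [tauto|]; intros E.
          apply Ht; rewrite <- E; apply increments_length.
      + replace (fun w => increments 0 m w = xs) with (fun _ : Omega => False).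
        * rewrite (P_False F P HP), Rmult_0_l, <- (P_False F P HP); f_equal.
          apply event_ext; intros w; split; [|tauto]; intros [E _].
          apply Hm; rewrite <- E; apply increments_length.
        * apply event_ext; intros w; split; [tauto|]; intros E.
          apply Hm; rewrite <- E; apply increments_length. }
  assert (H := P_countable_proportional F P HP _ enum_lists_surj
      (fun w => b (increments m t w)) (fun _ => True) (increments 0 m) (increments 0 m)
      a (P (fun w => b (increments 0 t w)))).
  cbv beta in H.
  replace (fun w => a (increments 0 m w) /\ b (increments m t w))
    with (fun w => b (increments m t w) /\ a (increments 0 m w)) by (apply event_ext; tauto).
  rewrite H.
  - rewrite Rmult_comm; do 2 f_equal; apply event_ext; tauto.
  - apply F_increments.
  - apply (F_const F P HP).
  - apply F_increments_eq.
  - apply F_increments_eq.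
  - intros xs.
    replace (fun w => True /\ increments 0 m w = xs)
        with (fun w => increments 0 m w = xs) by (apply event_ext; tauto).
    rewrite Rmult_comm, <- Hcyl; f_equal; apply event_ext; tauto.
Qed.

(** * Hitting probabilities and the truncated Green function *)

Lemma vsum_length s m w : length (vsum (increments s m w)) = d.
Proof.
  unfold increments; revert s; induction m as [|m IH]; intros s; simpl;
    [apply zerov_length|].
  apply vadd_length; [apply Hxi|apply IH].
Qed.

Lemma vsum_increments_add s m n w :
  vsum (increments s (m + n) w) =
  vadd (vsum (increments s m w)) (vsum (increments (s + m) n w)).
Proof.
  revert s; induction m as [|m IH]; intros s.
  - rewrite Nat.add_0_r; pose proof (vadd_zerov_l (vsum (increments s n w))) as H.
    rewrite vsum_length in H; symmetry; exact H.
  - change (vadd (xi s w) (vsum (increments (S s) (m + n) w)) =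
      vadd (vadd (xi s w) (vsum (increments (S s) m w)))
           (vsum (increments (s + S m) n w))).
    rewrite IH, <- vadd_assoc, Nat.add_succ_comm; reflexivity.
Qed.

Lemma walk_length n w : length (walk d xi n w) = d.
Proof. apply (vsum_length 0). Qed.

Lemma walk_add m n w :
  walk d xi (m + n) w = vadd (walk d xi m w) (vsum (increments m n w)).
Proof. apply (vsum_increments_add 0). Qed.

Lemma F_walk n (a : list Z -> Prop) : F (fun w => a (walk d xi n w)).
Proof. apply (F_increments 0 n (fun xs => a (vsum xs))). Qed.

Lemma firstn_increments s k m w : (k <= m)%nat ->
  firstn k (increments s m w) = increments s k w.
Proof.
  intros H; replace m with (k + (m - k))%nat by lia.
  rewrite increments_app, firstn_app, increments_length, Nat.sub_diag, app_nil_r.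
  apply firstn_all2; rewrite increments_length; lia.
Qed.

(** The Markov property at a fixed time. The predicate [a] carries the information about the past,
    such as the absence of an earlier visit. *)
Lemma P_walk_markov (a : list (list Z) -> Prop) m l x y :
  length x = d -> length y = d ->
  P (fun w => (a (increments 0 m w) /\ walk d xi m w = x) /\ walk d xi (m + l) w = y) =
  P (fun w => a (increments 0 m w) /\ walk d xi m w = x) *
  P (fun w => walk d xi l w = vsub y x).
Proof.
  intros Hx Hy.
  etransitivity; [|exact (P_increments_indep m l (fun xs => a xs /\ vsum xs = x)
     (fun xs => vsum xs = vsub y x))].
  f_equal; apply event_ext; intros w.
  rewrite walk_add. pose proof (vsum_length m l w).
  change (vsum (increments 0 m w)) with (walk d xi m w).
  split; intros [[H1 H2] H3]; (split; [tauto|]); revert H3; rewrite H2;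
    apply vadd_eq_iff; congruence.
Qed.

Definition truncated_green (T : nat) (x : list Z) : R :=
  sum_f_R0 (fun k => P (fun w => walk d xi k w = x)) T.

Lemma truncated_green_nonneg T x : 0 <= truncated_green T x.
Proof.
  apply cond_pos_sum; intros k; apply (P_nonneg F P HP), (F_walk k (fun y => y = x)).
Qed.

Lemma F_hit s T x : F (fun w => exists k, (k <= T)%nat /\ vsum (increments s k w) = x).
Proof.
  apply (F_ex_le F P HP (fun k w => vsum (increments s k w) = x)).
  intros k; apply (F_increments s k (fun xs => vsum xs = x)).
Qed.

(* Decomposition according to the first visit to [x]. *)
Lemma truncated_green_le_hit T x : length x = d ->
  truncated_green T x <=
  P (fun w => exists k, (k <= T)%nat /\ walk d xi k w = x) * truncated_green T (zerov d).
Proof.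
  intros Hx.
  set (tau := fun j w => walk d xi j w = x /\ forall i, (i < j)%nat -> walk d xi i w <> x).
  assert (HF : forall k, F (fun w => walk d xi k w = x))
    by (intros k; apply (F_walk k (fun y => y = x))).
  assert (Htau : forall j, F (tau j))
    by (intros j; apply (F_first F P HP (fun j w => walk d xi j w = x)); auto).
  assert (Hd : forall m n, m <> n -> forall w, tau m w -> tau n w -> False).
  { intros m n Hmn w [H1 H2] [H3 H4].
    destruct (Nat.lt_total m n) as [L|[L|L]]; [apply (H4 m)|lia|apply (H2 n)]; auto. }
  assert (Hhit : forall k w, walk d xi k w = x -> exists j, (j <= k)%nat /\ tau j w)
    by (intros k w Hk; apply (first_exists (fun k => walk d xi k w = x)), Hk).
  replace (P (fun w => exists k, (k <= T)%nat /\ walk d xi k w = x))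
    with (sum_f_R0 (fun j => P (tau j)) T).
  2:{ rewrite <- (P_ex_le_disjoint F P HP tau) by auto.
      f_equal; apply event_ext; intros w; split.
      - intros [k [Hk [H _]]]; eauto.
      - intros [k [Hk H]]; destruct (Hhit k w H) as [j [Hj H']].
        exists j; split; auto; lia. }
  unfold truncated_green at 1.
  (* A walk at [x] at time [k] first came there at some [j <= k] and then made a loop of length
     [k - j]; summing over [k] leaves a truncated convolution. *)
  rewrite (sum_eq _ (fun k => sum_f_R0
     (fun j => P (tau j) * P (fun w => walk d xi (k - j) w = zerov d)) k)).
  - apply (sum_convolution_le (fun j => P (tau j)) (fun k => P (fun w => walk d xi k w = zerov d)));
      intros; apply (P_nonneg F P HP); auto; apply (F_walk _ (fun y => y = zerov d)).
  - intros k _.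
    transitivity (P (fun w => exists j, (j <= k)%nat /\ (tau j w /\ walk d xi k w = x))).
    { f_equal; apply event_ext; intros w; split.
      - intros Hk; destruct (Hhit k w Hk) as [j [Hj Ht]]; eauto.
      - now intros [j [_ [_ H]]]. }
    rewrite (P_ex_le_disjoint F P HP (fun j w => tau j w /\ walk d xi k w = x)).
    + apply sum_eq; intros j Hj.
      replace (zerov d) with (vsub x x) by (rewrite vsub_diag, Hx; reflexivity).
      (* The Markov property requires a predicate of the first [j] increments, so earlier positions
         are read off prefixes of that block. *)
      assert (E : tau j = (fun w => (forall i, (i < j)%nat ->
                    vsum (firstn i (increments 0 j w)) <> x) /\ walk d xi j w = x)).
      { apply event_ext; intros w; unfold tau; split; intros [H1 H2]; split; auto;
          intros i Hi; [rewrite firstn_increments by lia; apply (H2 i Hi)|].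
        specialize (H1 i Hi); rewrite firstn_increments in H1 by lia; exact H1. }
      rewrite E.
      rewrite <- (P_walk_markov (fun xs => forall i, (i < j)%nat -> vsum (firstn i xs) <> x))
        by auto.
      now replace (j + (k - j))%nat with k by lia.
    + intros n; now apply (F_and F P HP).
    + intros m n Hmn w [H1 _] [H2 _]; exact (Hd m n Hmn w H1 H2).
Qed.

Lemma truncated_green_le_origin T x : length x = d ->
  truncated_green T x <= truncated_green T (zerov d).
Proof.
  intros Hx; eapply Rle_trans; [apply truncated_green_le_hit, Hx|].
  rewrite <- Rmult_1_l; apply Rmult_le_compat_r; [apply truncated_green_nonneg|].
  apply (P_le_1 F P HP), (F_hit 0).
Qed.

(** Union bound over the time [i] and the lag [l], each term split by the Markov property. Since [l]
    runs up to [T] independently of [i], the double sum is exactly a product. *)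
Lemma P_hit_then_le T x y : length x = d -> length y = d ->
  P (fun w => exists i, (i <= T)%nat /\ exists l, (l <= T)%nat /\
                (walk d xi i w = x /\ walk d xi (i + l) w = y))
  <= truncated_green T x * truncated_green T (vsub y x).
Proof.
  intros Hx Hy.
  assert (HF : forall i l, F (fun w => walk d xi i w = x /\ walk d xi (i + l) w = y)).
  { intros i l; apply (F_and F P HP);
      [apply (F_walk i (fun z => z = x))|apply (F_walk (i + l) (fun z => z = y))]. }
  eapply Rle_trans.
  { apply (P_ex_le_sum F P HP (fun i w => exists l, (l <= T)%nat /\
                (walk d xi i w = x /\ walk d xi (i + l) w = y))).
    intros i; apply (F_ex_le F P HP (fun l w => walk d xi i w = x /\ walk d xi (i + l) w = y)).
    auto. }
  unfold truncated_green at 1; rewrite Rmult_comm, scal_sum.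
  apply sum_Rle; intros i Hi.
  eapply Rle_trans.
  { apply (P_ex_le_sum F P HP (fun l w => walk d xi i w = x /\ walk d xi (i + l) w = y)).
    auto. }
  unfold truncated_green; rewrite scal_sum; apply sum_Rle; intros l Hl.
  rewrite Rmult_comm.
  assert (H := P_walk_markov (fun _ => True) i l x y Hx Hy); cbv beta in H.
  replace (fun w => True /\ walk d xi i w = x) with (fun w => walk d xi i w = x) in H
    by (apply event_ext; tauto).
  rewrite <- H; right; f_equal; apply event_ext; tauto.
Qed.

(** Given a visit to each point, one of them comes no later than the other; each order contributes
    one product. *)
Lemma P_hit_both_le T x y : length x = d -> length y = d ->
  P (fun w => (exists k, (k <= T)%nat /\ walk d xi k w = x) /\
              (exists k, (k <= T)%nat /\ walk d xi k w = y))
  <= truncated_green T x * truncated_green T (vsub y x)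
     + truncated_green T y * truncated_green T (vsub x y).
Proof.
  intros Hx Hy.
  set (H := fun x y w => exists i, (i <= T)%nat /\ exists l, (l <= T)%nat /\
                (walk d xi i w = x /\ walk d xi (i + l) w = y)).
  assert (HF : forall x y, F (H x y)).
  { intros x' y'; apply (F_ex_le F P HP (fun i w => exists l, (l <= T)%nat /\
                (walk d xi i w = x' /\ walk d xi (i + l) w = y'))).
    intros i; apply (F_ex_le F P HP (fun l w => walk d xi i w = x' /\ walk d xi (i + l) w = y')).
    intros l; apply (F_and F P HP);
      [apply (F_walk i (fun z => z = x'))|apply (F_walk (i + l) (fun z => z = y'))]. }
  apply Rle_trans with (P (fun w => H x y w \/ H y x w)).
  - apply (P_mono F P HP).
    + apply (F_and F P HP); apply (F_hit 0).
    + now apply (F_or F P HP).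
    + intros w [[i [Hi Hix]] [j [Hj Hjy]]].
      destruct (Nat.le_ge_cases i j) as [L|L]; [left|right].
      * exists i; split; auto; exists (j - i)%nat; split; [lia|].
        now replace (i + (j - i))%nat with j by lia.
      * exists j; split; auto; exists (i - j)%nat; split; [lia|].
        now replace (j + (i - j))%nat with i by lia.
  - eapply Rle_trans; [apply (P_or_le F P HP); auto|].
    apply Rplus_le_compat; apply P_hit_then_le; auto.
Qed.

End Walk.

(** * Norms and box sums *)

Lemma sum_sq_nonneg x : 0 <= fold_right Rplus 0 (map (fun z => IZR z ^ 2) x).
Proof.
  induction x as [|a x IH]; cbn [map fold_right]; [lra|].
  pose proof (pow2_ge_0 (IZR a)); lra.
Qed.

Lemma enorm_ge_coord x z : In z x -> Rabs (IZR z) <= enorm x.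
Proof.
  intros Hz; unfold enorm; rewrite <- sqrt_pow2 at 1 by apply Rabs_pos.
  apply sqrt_le_1_alt; rewrite pow2_abs.
  induction x as [|a x IH]; [easy|]; cbn [map fold_right].
  pose proof (sum_sq_nonneg x); pose proof (pow2_ge_0 (IZR a)).
  destruct Hz as [->|Hz]; [lra|]; specialize (IH Hz); lra.
Qed.

(** The factor [length x + 1] is a crude bound for the square root of the length that stays positive
    in dimension 0, as a base of [Rpower] should. *)
Lemma enorm_le x b : 0 <= b -> (forall z, In z x -> Rabs (IZR z) <= b) ->
  enorm x <= (INR (length x) + 1) * b.
Proof.
  intros Hb H.
  assert (E : fold_right Rplus 0 (map (fun z => IZR z ^ 2) x) <= INR (length x) * b ^ 2).
  { induction x as [|a x IH]; cbn [map fold_right length]; [simpl; lra|].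
    rewrite S_INR. specialize (IH (fun z Hz => H z (or_intror Hz))).
    specialize (H a (or_introl eq_refl)).
    assert (IZR a ^ 2 <= b ^ 2)
      by (rewrite <- pow2_abs; apply pow_incr; split; auto using Rabs_pos).
    lra. }
  pose proof (pos_INR (length x)) as Hl.
  unfold enorm; rewrite <- (sqrt_pow2 ((INR (length x) + 1) * b)) by nra.
  apply sqrt_le_1_alt; eapply Rle_trans; [exact E|].
  pose proof (pow2_ge_0 b); rewrite Rpow_mult_distr; apply Rmult_le_compat_r; nra.
Qed.

Lemma IZR_pow2 k : IZR (2 ^ Z.of_nat k) = 2 ^ k.
Proof. rewrite <- pow_IZR; reflexivity. Qed.

Lemma enorm_ge_outside d k x : length x = d -> ~ In x (Vbox d k) -> 2 ^ k <= enorm x.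
Proof.
  intros Hx Hn.
  assert (E : exists z, In z x /\ ~ (- 2 ^ Z.of_nat k <= z < 2 ^ Z.of_nat k)%Z).
  { apply NNPP; intros Hc; apply Hn, In_Vbox; split; auto.
    intros z Hz; apply NNPP; intros Hc'; apply Hc; eauto. }
  destruct E as [z [Hz Hk]]; eapply Rle_trans; [|apply (enorm_ge_coord x z Hz)].
  rewrite <- IZR_pow2, <- abs_IZR; apply IZR_le; lia.
Qed.

Lemma enorm_ge_1 d x : length x = d -> x <> zerov d -> 1 <= enorm x.
Proof.
  intros Hx Hn.
  assert (E : exists z, In z x /\ z <> 0%Z).
  { apply NNPP; intros Hc; apply Hn; rewrite <- Hx; apply Forall_eq_repeat, Forall_forall.
    intros z Hz; apply NNPP; intros Hc'; apply Hc; exists z; split; auto. }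
  destruct E as [z [Hz Hk]]; eapply Rle_trans; [|apply (enorm_ge_coord x z Hz)].
  rewrite <- abs_IZR; apply IZR_le; lia.
Qed.

Lemma length_Vbox d n : INR (length (Vbox d n)) = (2 * 2 ^ n) ^ d.
Proof.
  unfold Vbox; rewrite length_box, pow_INR; f_equal.
  rewrite INR_IZR_INZ, Z2Nat.id by lia.
  now rewrite mult_IZR, IZR_pow2.
Qed.

Lemma count_in_box_le d A n : count_in_box d A n <= (2 * 2 ^ n) ^ d.
Proof.
  unfold count_in_box; rewrite <- length_Vbox, <- (Rmult_1_r (INR _)), <- lsum_const.
  apply lsum_le; intros x _; apply ind_bounds.
Qed.

Lemma count_in_box_ge_1 d (A : list Z -> Prop) n : A (zerov d) -> 1 <= count_in_box d A n.
Proof.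
  intros HA; unfold count_in_box.
  replace 1 with (lsum (fun x => ind (A x)) [zerov d]).
  - apply lsum_incl.
    + repeat constructor; easy.
    + intros x [<-|[]]; apply zerov_Vbox.
    + intros x _; apply ind_bounds.
  - cbn; rewrite ind_true by auto; lra.
Qed.

Lemma count_in_box_mono d (A B : list Z -> Prop) n :
  (forall x, A x -> B x) -> count_in_box d A n <= count_in_box d B n.
Proof. intros H; apply lsum_le; intros x _; apply ind_le, H. Qed.

Lemma lsum_restrict_le {A : Type} (f : A -> R) l1 l2 :
  NoDup l1 -> (forall x, In x l2 -> 0 <= f x) ->
  lsum (fun x => ind (In x l2) * f x) l1 <= lsum f l2.
Proof.
  intros Hnd Hf.
  set (t := fun x => if excluded_middle_informative (In x l2) then true else false).
  replace (lsum (fun x => ind (In x l2) * f x) l1) with (lsum f (filter t l1)).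
  - apply lsum_incl; auto using NoDup_filter.
    intros x Hx; apply filter_In in Hx; destruct Hx as [_ Hx]; revert Hx; unfold t.
    destruct excluded_middle_informative; easy.
  - clear Hnd; induction l1 as [|a l1 IH]; [reflexivity|]; cbn [filter].
    unfold t at 1; change (lsum (fun x => ind (In x l2) * f x) (a :: l1))
      with (ind (In a l2) * f a + lsum (fun x => ind (In x l2) * f x) l1).
    rewrite <- IH; unfold ind; destruct excluded_middle_informative.
    + unfold lsum; simpl; lra.
    + lra.
Qed.

Lemma Rpower_2_pow gamma k : Rpower (2 ^ k) gamma = Rpower 2 gamma ^ k.
Proof.
  rewrite <- !Rpower_pow by (try apply exp_pos; lra).
  rewrite !Rpower_mult; f_equal; ring.
Qed.

Lemma ln_2_pos : 0 < ln 2.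
Proof. rewrite <- ln_1; apply ln_increasing; lra. Qed.

Lemma log2_pow r n : 0 < r -> log2 (r ^ n) = INR n * log2 r.
Proof. intros Hr; unfold log2; rewrite ln_pow by auto; unfold Rdiv; ring. Qed.

Lemma log2_Rpower gamma : log2 (Rpower 2 gamma) = gamma.
Proof. unfold log2; rewrite ln_Rpower; field; pose proof ln_2_pos; lra. Qed.

Lemma log2_le x y : 0 < x -> x <= y -> log2 x <= log2 y.
Proof.
  intros Hx Hxy; unfold log2; apply Rmult_le_compat_r.
  - left; apply Rinv_0_lt_compat, ln_2_pos.
  - destruct Hxy as [Hlt| ->]; [left; now apply ln_increasing|lra].
Qed.

Lemma archimed_nat x : exists n : nat, x < INR n.
Proof.
  destruct (Rle_or_lt 0 x) as [H|H].
  - destruct (INR_archimed 1 x) as [n Hn]; [lra|]; exists n; lra.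
  - exists 0%nat; simpl; lra.
Qed.

Section Transient.

Context {Omega : Type} (d : nat) (F : event Omega -> Prop) (P : event Omega -> R).
Context (xi : nat -> Omega -> list Z) (mu : list Z -> R) (G : list Z -> R).
Context (HP : is_prob_space Omega F P) (Hxi : iid_increments d F P xi mu).
Context (HG : green_function d P xi G).

(** * The Green function *)

Lemma truncated_green_le_green T x : length x = d -> truncated_green d P xi T x <= G x.
Proof.
  intros Hx; apply sum_incr.
  - exact (HG x Hx).
  - intros n; apply (P_nonneg F P HP), (F_walk d F P xi mu HP Hxi n (fun y => y = x)).
Qed.

Lemma green_nonneg x : length x = d -> 0 <= G x.
Proof.
  intros Hx; eapply Rle_trans; [|apply (truncated_green_le_green 0 x Hx)].
  apply (truncated_green_nonneg d F P xi mu HP Hxi).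
Qed.

Lemma green_origin_ge_1 : 1 <= G (zerov d).
Proof.
  eapply Rle_trans; [|apply (truncated_green_le_green 0), zerov_length].
  unfold truncated_green; simpl; rewrite <- (P_True F P HP) at 1.
  right; f_equal; apply event_ext; intros w; split; auto.
Qed.

Lemma green_le_origin x : length x = d -> G x <= G (zerov d).
Proof.
  intros Hx.
  apply (Rle_cv_lim (Un := fun T => truncated_green d P xi T x)
                    (Vn := fun T => truncated_green d P xi T (zerov d))).
  - intros T; now apply (truncated_green_le_origin d F P xi mu HP Hxi).
  - exact (HG x Hx).
  - exact (HG (zerov d) (zerov_length d)).
Qed.

(** * Growth of the Green function over dyadic boxes *)

Definition green_box (n : nat) : R := lsum G (Vbox d n).

Lemma green_box_ge_1 n : 1 <= green_box n.
Proof.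
  eapply Rle_trans; [apply green_origin_ge_1|].
  replace (G (zerov d)) with (lsum G [zerov d]) by (cbn; lra).
  apply lsum_incl.
  - repeat constructor; easy.
  - intros x [<-|[]]; apply zerov_Vbox.
  - intros x Hx; eapply green_nonneg, Vbox_length, Hx.
Qed.

Lemma green_box_mono j k : (j <= k)%nat -> green_box j <= green_box k.
Proof.
  intros H; apply lsum_incl.
  - apply NoDup_Vbox.
  - now apply Vbox_mono.
  - intros x Hx; eapply green_nonneg, Vbox_length, Hx.
Qed.

Lemma green_box_le n : green_box n <= G (zerov d) * (2 * 2 ^ n) ^ d.
Proof.
  rewrite <- length_Vbox, Rmult_comm, <- lsum_const.
  apply lsum_le; intros x Hx; eapply green_le_origin, Vbox_length, Hx.
Qed.

(** Convergence at each point of a finite box gives convergence of the sums, and the limit is at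
    least 1, so half of it is reached at a finite time. This time depends on [n]. *)
Lemma truncated_green_box_approx n :
  exists T, green_box n <= 2 * lsum (truncated_green d P xi T) (Vbox d n).
Proof.
  assert (H : Un_cv (fun T => lsum (truncated_green d P xi T) (Vbox d n)) (green_box n)).
  { unfold green_box.
    assert (Hl : forall x, In x (Vbox d n) -> length x = d)
      by (intros x Hx; eapply Vbox_length, Hx).
    induction (Vbox d n) as [|a l IH].
    - intros eps Heps; exists 0%nat; intros; cbn.
      unfold Rdist; rewrite Rminus_diag, Rabs_R0; auto.
    - apply (CV_plus (fun T => truncated_green d P xi T a)).
      + apply HG, Hl; now left.
      + apply IH; intros x Hx; apply Hl; now right. }
  pose proof (green_box_ge_1 n).
  destruct (H (green_box n / 2) ltac:(lra)) as [T HT]; exists T.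
  specialize (HT T (le_n T)); unfold Rdist in HT; apply Rabs_def2 in HT; lra.
Qed.

Lemma green_sum_term_nonneg gamma x : length x = d ->
  0 <= ind (x <> zerov d) * (G x / Rpower (enorm x) gamma).
Proof.
  intros Hx; apply Rmult_le_pos; [apply ind_bounds|].
  apply Rmult_le_pos; [now apply green_nonneg|].
  left; apply Rinv_0_lt_compat, exp_pos.
Qed.

(** Nonzero points of the box have norm at most [(d + 1) * 2^n], so [G x] is at most
    [D * 2^(gamma n)] times its term in the convergent series. The origin is absent from the series
    and is added separately. *)
Lemma green_box_growth gamma : 0 <= gamma -> green_sum_finite d G gamma ->
  exists C, forall n, green_box n <= C * Rpower 2 gamma ^ n.
Proof.
  intros Hg [M HM].
  set (D := Rpower (INR d + 1) gamma).
  exists (G (zerov d) + D * M); intros n.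
  assert (Hr : 1 <= Rpower 2 gamma ^ n).
  { apply pow_R1_Rle; rewrite <- (Rpower_O 2) by lra; apply Rle_Rpower; lra. }
  assert (Hpt : forall x, In x (Vbox d n) -> G x <=
     ind (In x [zerov d]) * G x + D * Rpower 2 gamma ^ n *
      (ind (x <> zerov d) * (G x / Rpower (enorm x) gamma))).
  { intros x Hx; apply In_Vbox in Hx; destruct Hx as [Lx Hx].
    destruct (classic (x = zerov d)) as [Hz|Hz].
    - rewrite (ind_true (In x _)), (ind_false (x <> _)) by (simpl; auto); lra.
    - rewrite (ind_false (In x _)), (ind_true (x <> _)) by (simpl; intuition congruence).
      pose proof (enorm_ge_1 d x Lx Hz) as H1.
      pose proof (pos_INR d) as Hd; pose proof (pow_lt 2 n ltac:(lra)) as H2n.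
      assert (Hen : enorm x <= (INR d + 1) * 2 ^ n).
      { rewrite <- Lx; apply enorm_le; [lra|].
        intros z Hz'; rewrite <- abs_IZR, <- IZR_pow2; apply IZR_le.
        specialize (Hx z Hz'); lia. }
      assert (Hp : Rpower (enorm x) gamma <= D * Rpower 2 gamma ^ n).
      { unfold D; rewrite <- Rpower_2_pow, Rpower_mult_distr by lra.
        apply Rle_Rpower_l; lra. }
      assert (Hpos : 0 < Rpower (enorm x) gamma) by apply exp_pos.
      replace (G x) with (Rpower (enorm x) gamma * (G x / Rpower (enorm x) gamma)) at 1
        by (field; lra).
      rewrite Rmult_0_l, Rplus_0_l, Rmult_1_l; apply Rmult_le_compat_r; auto.
      apply Rmult_le_pos; [now apply green_nonneg|left; now apply Rinv_0_lt_compat]. }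
  unfold green_box; eapply Rle_trans; [apply lsum_le, Hpt|].
  rewrite lsum_plus, lsum_scal, Rmult_plus_distr_r; apply Rplus_le_compat.
  - eapply Rle_trans; [apply lsum_restrict_le; [apply NoDup_Vbox|]|].
    + intros x [<-|[]]; apply green_nonneg, zerov_length.
    + cbn; pose proof green_origin_ge_1; nra.
  - replace (D * M * Rpower 2 gamma ^ n) with (D * Rpower 2 gamma ^ n * M) by ring.
    apply Rmult_le_compat_l; auto.
    apply Rmult_le_pos; [left; apply exp_pos|lra].
Qed.

(* Dyadic decomposition: outside [Vbox d k] the norm is at least [2 ^ k]. *)
Lemma green_sum_finite_of_growth gamma gamma' n0 : 0 <= gamma' < gamma ->
  (forall n, (n0 <= n)%nat -> green_box n <= Rpower 2 gamma' ^ n) ->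
  green_sum_finite d G gamma.
Proof.
  intros Hg Hn0.
  set (r := Rpower 2 gamma); set (r' := Rpower 2 gamma') in *.
  assert (Hr' : 1 <= r')
    by (unfold r'; rewrite <- (Rpower_O 2) by lra; apply Rle_Rpower; lra).
  assert (Hrr : r' < r) by (apply Rpower_lt; lra).
  set (C := 1 + green_box n0).
  pose proof (green_box_ge_1 n0) as HC1.
  (* Below [n0] monotonicity bounds [green_box n] by [green_box n0], and [r' >= 1] lets one constant
     serve all scales. *)
  assert (HC : forall n, green_box n <= C * r' ^ n).
  { intros n; pose proof (pow_R1_Rle r' n Hr').
    destruct (Nat.le_gt_cases n0 n) as [L|L].
    - specialize (Hn0 n L); unfold C; nra.
    - pose proof (green_box_mono n n0 ltac:(lia)); unfold C; nra. }
  set (f := fun x => ind (x <> zerov d) * (G x / Rpower (enorm x) gamma)).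
  assert (Hf : forall x, length x = d -> 0 <= f x) by (intros; now apply green_sum_term_nonneg).
  set (rho := r' / r).
  assert (Hrho : 0 <= rho < 1).
  { unfold rho; split; [apply Rmult_le_pos; [lra|left; apply Rinv_0_lt_compat; lra]|].
    apply (Rmult_lt_reg_r r); [lra|]; field_simplify; lra. }
  assert (Hstep : forall k, lsum f (Vbox d (S k)) <= lsum f (Vbox d k) + C * r' * rho ^ k).
  { intros k.
    assert (Hk : 0 < / r ^ k) by (apply Rinv_0_lt_compat, pow_lt; lra).
    apply Rle_trans with (lsum (fun x => ind (In x (Vbox d k)) * f x + / r ^ k * G x)
                               (Vbox d (S k))).
    - apply lsum_le; intros x Hx; apply Vbox_length in Hx.
      pose proof (green_nonneg x Hx) as HGx; pose proof (Hf x Hx) as Hfx.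
      destruct (classic (In x (Vbox d k))) as [Hin|Hout].
      + rewrite ind_true by auto; nra.
      + rewrite ind_false by auto.
        pose proof (enorm_ge_outside d k x Hx Hout) as He.
        assert (Hp : r ^ k <= Rpower (enorm x) gamma).
        { unfold r; rewrite <- Rpower_2_pow; apply Rle_Rpower_l; [lra|].
          split; auto; apply pow_lt; lra. }
        assert (0 < r ^ k) by (apply pow_lt; lra).
        assert (/ Rpower (enorm x) gamma <= / r ^ k) by now apply Rinv_le_contravar.
        assert (0 < / Rpower (enorm x) gamma) by (apply Rinv_0_lt_compat; lra).
        pose proof (ind_bounds (x <> zerov d)) as [Hi1 Hi2].
        unfold f, Rdiv. assert (0 <= G x * / Rpower (enorm x) gamma) by nra.
        assert (G x * / Rpower (enorm x) gamma <= G x * / r ^ k) by nra.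
        nra.
    - rewrite lsum_plus, lsum_scal; apply Rplus_le_compat.
      + apply lsum_restrict_le; [apply NoDup_Vbox|].
        intros x Hx; eapply Hf, Vbox_length, Hx.
      + apply Rle_trans with (/ r ^ k * (C * r' ^ S k)).
        * apply Rmult_le_compat_l; [lra|apply HC].
        * right; unfold rho, Rdiv; rewrite Rpow_mult_distr, pow_inv; simpl; ring. }
  assert (HA : 0 <= C * r') by (unfold C; nra).
  exists (lsum f (Vbox d 0) + C * r' / (1 - rho)); intros k.
  (* The closed form of the partial geometric sum is what the induction on [k] carries; the bound by
     the full series would not reproduce itself. *)
  apply Rle_trans with (lsum f (Vbox d 0) + C * r' / (1 - rho) * (1 - rho ^ k)).
  - change (lsum f (Vbox d k) <= lsum f (Vbox d 0) + C * r' / (1 - rho) * (1 - rho ^ k)).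
    induction k as [|k IH]; [simpl; lra|].
    eapply Rle_trans; [apply Hstep|].
    replace (C * r' / (1 - rho) * (1 - rho ^ S k)) with
      (C * r' / (1 - rho) * (1 - rho ^ k) + C * r' * rho ^ k) by (simpl; field; lra).
    lra.
  - pose proof (pow_le rho k ltac:(lra)).
    assert (0 <= C * r' / (1 - rho))
      by (apply Rmult_le_pos; [lra|left; apply Rinv_0_lt_compat; lra]).
    nra.
Qed.

(* If doubling failed at all large scales, [green_box] would outgrow the
   cardinality of the boxes. *)
Lemma doubling_scales gamma gamma' : 0 <= gamma' < gamma -> gamma' <= INR d ->
  ~ green_sum_finite d G gamma ->
  forall N, exists n, (N <= n)%nat /\ Rpower 2 gamma' ^ n <= green_box n /\
                      green_box (S n) <= 2 * 2 ^ d * green_box n.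
Proof.
  intros Hg Hgd Hinf N; apply NNPP; intros Hno.
  set (r' := Rpower 2 gamma') in *.
  assert (Hr'pos : 0 < r') by apply exp_pos.
  assert (Hr' : r' <= 2 ^ d).
  { unfold r'; rewrite <- Rpower_pow by lra; apply Rle_Rpower; lra. }
  assert (E : exists n, (N <= n)%nat /\ r' ^ n <= green_box n).
  { apply NNPP; intros Hc; apply Hinf, (green_sum_finite_of_growth gamma gamma' N Hg).
    intros n Hn; apply Rnot_lt_le; intros Hlt; apply Hc; exists n; split; [auto|].
    now left. }
  destruct E as [n1 [HN Hn1]].
  assert (H2d : 0 < 2 ^ d) by (apply pow_lt; lra).
  (* The first conjunct keeps every later scale a candidate: a failed doubling multiplies
     [green_box] by more than [2 * 2^d], which exceeds [r'], so the doubling must fail again. *)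
  assert (HJ : forall j, r' ^ (n1 + j) <= green_box (n1 + j) /\
                         (2 * 2 ^ d) ^ j <= green_box (n1 + j)).
  { induction j as [|j [IH1 IH2]].
    - rewrite Nat.add_0_r; split; auto; simpl; apply green_box_ge_1.
    - rewrite Nat.add_succ_r.
      assert (Hlt : 2 * 2 ^ d * green_box (n1 + j) < green_box (S (n1 + j))).
      { apply Rnot_le_lt; intros Hle; apply Hno; exists (n1 + j)%nat; split; [lia|auto]. }
      pose proof (green_box_ge_1 (n1 + j)).
      assert (0 < r' ^ (n1 + j)) by now apply pow_lt.
      split; cbn [pow]; nra. }
  set (D := G (zerov d) * (2 * 2 ^ n1) ^ d).
  destruct (Pow_x_infinity 2 ltac:(rewrite Rabs_pos_eq; lra) (D + 1)) as [j Hj].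
  specialize (Hj j (le_n j)); rewrite Rabs_pos_eq in Hj by (apply pow_le; lra).
  destruct (HJ j) as [_ H2]; pose proof (green_box_le (n1 + j)) as H3.
  assert (Hpj : 0 < (2 ^ d) ^ j) by now apply pow_lt.
  (* After the volume [(2^d)^j] is cancelled, the spare factor 2 of the doubling constant leaves
     [2^j], which has no upper bound. *)
  assert (2 ^ j * (2 ^ d) ^ j <= D * (2 ^ d) ^ j).
  { rewrite <- Rpow_mult_distr; eapply Rle_trans; [exact H2|].
    eapply Rle_trans; [exact H3|]; right; unfold D.
    rewrite pow_add, <- (Rmult_assoc 2), (Rpow_mult_distr (2 * 2 ^ n1)).
    rewrite <- !pow_mult, (Nat.mul_comm j d); ring. }
  nra.
Qed.

(** * Second moment bound for the number of visited points *)

(** A function of the list of increments, not of the walk, so that it applies equally to the block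
    following a restart. *)
Definition visited (zs : list (list Z)) (x : list Z) : Prop :=
  exists k, (k <= length zs)%nat /\ vsum d (firstn k zs) = x.

Lemma visited_increments s T w x :
  visited (increments xi s T w) x <->
  exists k, (k <= T)%nat /\ vsum d (increments xi s k w) = x.
Proof.
  unfold visited; rewrite increments_length.
  split; intros [k [Hk H]]; exists k; split; auto;
    revert H; rewrite firstn_increments; auto.
Qed.

Lemma visited_walk T w x :
  visited (increments xi 0 T w) x <-> exists k, (k <= T)%nat /\ walk d xi k w = x.
Proof. apply visited_increments. Qed.

Lemma visited_range T w x : visited (increments xi 0 T w) x -> range_of d xi w x.
Proof. intros H; apply visited_walk in H; destruct H as [k [_ H]]; now exists k. Qed.

Lemma P_visited T x :
  P (fun w => visited (increments xi 0 T w) x) =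
  P (fun w => exists k, (k <= T)%nat /\ walk d xi k w = x).
Proof. f_equal; apply event_ext; intros w; apply visited_walk. Qed.

(** For fixed [x] the differences [y - x] are distinct points of the next box, so the sum over [y]
    is at most [green_box (S n)], uniformly in [x]. The other factor stays truncated, to be compared
    with a first moment bounded below by the same truncated sum. *)
Lemma second_moment_le T n :
  lsum (fun x => lsum (fun y => P (fun w =>
      visited (increments xi 0 T w) x /\ visited (increments xi 0 T w) y)) (Vbox d n))
    (Vbox d n)
  <= 2 * (lsum (truncated_green d P xi T) (Vbox d n) * green_box (S n)).
Proof.
  set (g := truncated_green d P xi T); set (V := Vbox d n).
  assert (Hg : forall x, 0 <= g x)
    by (intros x; apply (truncated_green_nonneg d F P xi mu HP Hxi)).
  assert (HV : forall x, In x V -> length x = d) by (intros x Hx; eapply Vbox_length, Hx).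
  assert (Hhalf : lsum (fun x => lsum (fun y => g x * g (vsub y x)) V) V
                  <= lsum g V * green_box (S n)).
  { rewrite Rmult_comm, <- lsum_scal; apply lsum_le; intros x Hx.
    rewrite lsum_scal, Rmult_comm; apply Rmult_le_compat_r; auto.
    apply Rle_trans with (lsum G (map (fun y => vsub y x) V)).
    - rewrite lsum_map; apply lsum_le; intros y Hy.
      apply truncated_green_le_green, vsub_length; auto.
    - apply lsum_incl.
      + apply NoDup_map_NoDup_ForallPairs; [|apply NoDup_Vbox].
        intros y z Hy Hz E; cbv beta in E.
        rewrite <- (proj2 (vadd_eq_iff x (vsub y x) y
                     ltac:(rewrite !HV; auto)
                     ltac:(rewrite (vsub_length d), HV; auto)) eq_refl).
        rewrite E.
        apply (proj2 (vadd_eq_iff x (vsub z x) z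
                     ltac:(rewrite !HV; auto)
                     ltac:(rewrite (vsub_length d), HV; auto)) eq_refl).
      + intros z Hz; apply in_map_iff in Hz; destruct Hz as [y [<- Hy]].
        now apply Vbox_vsub.
      + intros z Hz; eapply green_nonneg, Vbox_length, Hz. }
  apply Rle_trans with
    (lsum (fun x => lsum (fun y => g x * g (vsub y x) + g y * g (vsub x y)) V) V).
  - apply lsum_le; intros x Hx; apply lsum_le; intros y Hy.
    replace (fun w => visited (increments xi 0 T w) x /\ visited (increments xi 0 T w) y)
      with (fun w => (exists k, (k <= T)%nat /\ walk d xi k w = x) /\
                     (exists k, (k <= T)%nat /\ walk d xi k w = y))
      by (apply event_ext; intros w; now rewrite !visited_walk).
    apply (P_hit_both_le d F P xi mu HP Hxi); auto.
  - rewrite (lsum_ext _ (fun x => lsum (fun y => g x * g (vsub y x)) V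
                                + lsum (fun y => g y * g (vsub x y)) V))
      by (intros; apply lsum_plus).
    rewrite lsum_plus, (lsum_swap (fun x y => g y * g (vsub x y))); lra.
Qed.

(* The constant comes from
   [N <= theta + N^2 / (2 lambda) + lambda / 2 * 1_{N >= theta}]
   with [theta = green_box n / (4 G 0)] and [lambda = 8 K G 0 E], where [E] is
   the truncated Green function of the box. *)
Lemma paley_zygmund n T K :
  0 < K -> green_box (S n) <= K * green_box n ->
  green_box n <= 2 * lsum (truncated_green d P xi T) (Vbox d n) ->
  / (16 * K * G (zerov d) ^ 2) <=
  P (fun w => green_box n / (4 * G (zerov d)) <=
              count_in_box d (visited (increments xi 0 T w)) n).
Proof.
  intros HK Hdoub HT.
  set (V := Vbox d n) in *; set (g := lsum (truncated_green d P xi T) V) in *.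
  set (G0 := G (zerov d)) in *.
  pose proof green_origin_ge_1 as HG0; fold G0 in HG0.
  pose proof (green_box_ge_1 n) as Ha.
  set (theta := green_box n / (4 * G0)).
  set (H := fun x w => visited (increments xi 0 T w) x).
  set (D := fun w => theta <= count_in_box d (visited (increments xi 0 T w)) n).
  assert (HF : forall x, F (H x))
    by (intros x; apply (F_increments d F P xi mu HP Hxi 0 T (fun zs => visited zs x))).
  assert (HD : F D)
    by (apply (F_increments d F P xi mu HP Hxi 0 T
                 (fun zs => theta <= count_in_box d (visited zs) n))).
  set (lam := 8 * K * G0 * g).
  assert (Hg : 0 < g) by lra.
  assert (HKG : 0 < K * G0) by nra.
  assert (Hlam : 0 < lam) by (unfold lam; nra).
  (* The list encodes [- N + N^2 / (2 lam) + lam / 2 * 1_D], with [N] and [N^2] expanded into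
     indicators. *)
  set (l := map (fun x => (-1, H x)) V ++
            map (fun xy => (/ (2 * lam), fun w => H (fst xy) w /\ H (snd xy) w))
                (list_prod V V) ++ [(lam / 2, D)]).
  assert (Hlin : 0 <= theta + lsum (fun ca => fst ca * P (snd ca)) l).
  { apply (P_linear_nonneg F P HP).
    - intros ca Hca; unfold l in Hca; rewrite !in_app_iff, !in_map_iff in Hca.
      destruct Hca as [[x [<- _]]|[[xy [<- _]]|[<-|[]]]]; simpl; auto.
      now apply (F_and F P HP).
    - intros w; set (N := count_in_box d (visited (increments xi 0 T w)) n).
      assert (E : lsum (fun ca => fst ca * ind (snd ca w)) l =
                  - N + (/ (2 * lam) * (N * N) + lam / 2 * ind (D w))).
      { unfold l; rewrite !lsum_app, !lsum_map, lsum_list_prod; f_equal; [|f_equal].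
        - cbn [fst snd]; rewrite lsum_scal; unfold N, count_in_box, H; fold V; ring.
        - unfold N, count_in_box; rewrite lsum_mul, <- lsum_scal.
          apply lsum_ext; intros x _; rewrite <- lsum_scal.
          apply lsum_ext; intros y _; cbn [fst snd]; rewrite ind_and; reflexivity.
        - cbn; lra. }
      (* On [D] the three terms complete the square [(N - lam)^2 / (2 lam)]; off [D] the count is
         below [theta]. *)
      rewrite E; destruct (classic (D w)) as [Hw|Hw].
      + rewrite ind_true by auto.
        assert (0 <= theta) by (unfold theta; apply Rmult_le_pos;
          [lra|left; apply Rinv_0_lt_compat; lra]).
        replace (theta + (- N + (/ (2 * lam) * (N * N) + lam / 2 * 1)))
          with (theta + / (2 * lam) * (N - lam) ^ 2) by (field; lra).
        apply Rplus_le_le_0_compat; auto.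
        apply Rmult_le_pos; [left; apply Rinv_0_lt_compat; lra|apply pow2_ge_0].
      + rewrite ind_false by auto; unfold D in Hw; fold N in Hw.
        assert (0 <= / (2 * lam) * (N * N)); [|lra].
        apply Rmult_le_pos; [left; apply Rinv_0_lt_compat; lra|nra]. }
  set (EN := lsum (fun x => P (H x)) V).
  set (EN2 := lsum (fun x => lsum (fun y => P (fun w => H x w /\ H y w)) V) V).
  assert (E : lsum (fun ca => fst ca * P (snd ca)) l =
              - EN + (/ (2 * lam) * EN2 + lam / 2 * P D)).
  { unfold l; rewrite !lsum_app, !lsum_map, lsum_list_prod; f_equal; [|f_equal].
    - cbn [fst snd]; rewrite lsum_scal; unfold EN; ring.
    - unfold EN2; rewrite <- lsum_scal.
      apply lsum_ext; intros x _; rewrite <- lsum_scal; reflexivity.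
    - cbn; lra. }
  rewrite E in Hlin.
  assert (H1 : g / G0 <= EN).
  { unfold g, EN, Rdiv; rewrite Rmult_comm, <- lsum_scal; apply lsum_le; intros x Hx.
    apply Vbox_length in Hx; apply (Rmult_le_reg_l G0); [lra|].
    rewrite <- Rmult_assoc, Rinv_r, Rmult_1_l by lra.
    eapply Rle_trans; [apply (truncated_green_le_hit d F P xi mu HP Hxi T x Hx)|].
    rewrite Rmult_comm; unfold H; rewrite P_visited; apply Rmult_le_compat_r.
    - apply (P_nonneg F P HP), (F_hit d F P xi mu HP Hxi 0).
    - apply truncated_green_le_green, zerov_length. }
  assert (H2 : EN2 <= 4 * K * g ^ 2).
  { eapply Rle_trans; [apply second_moment_le|]; fold V; fold g.
    assert (g * green_box (S n) <= g * (K * (2 * g))); [|lra].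
    apply Rmult_le_compat_l; [lra|].
    eapply Rle_trans; [exact Hdoub|]; apply Rmult_le_compat_l; lra. }
  assert (H3 : theta <= g / (2 * G0)).
  { unfold theta; apply (Rmult_le_reg_r (4 * G0)); [lra|].
    replace (g / (2 * G0) * (4 * G0)) with (2 * g) by (field; lra).
    replace (green_box n / (4 * G0) * (4 * G0)) with (green_box n) by (field; lra); lra. }
  assert (H4 : / (2 * lam) * EN2 <= g / (4 * G0)).
  { apply Rle_trans with (/ (2 * lam) * (4 * K * g ^ 2)).
    - apply Rmult_le_compat_l; auto; left; apply Rinv_0_lt_compat; lra.
    - right; unfold lam; field; repeat split; lra. }
  (* In units of [u = g / (4 G0)], the mean is at least [4 u], [theta] at most [2 u] and the
     quadratic term at most [u], which leaves [u] for [lam / 2 * P D]. *)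
  assert (H5 : g / (4 * G0) <= lam / 2 * P D).
  { replace (g / (2 * G0)) with (2 * (g / (4 * G0))) in H3 by (field; lra).
    replace (g / G0) with (4 * (g / (4 * G0))) in H1 by (field; lra). lra. }
  apply (Rmult_le_reg_l (lam / 2)); [lra|].
  eapply Rle_trans; [|exact H5]; right; unfold lam; field; split; lra.
Qed.

(** * From positive probability to probability one *)

(** Translation by the position at time [S] is injective, carries points visited after the restart
    to points visited by the walk, and maps the box into the next one. *)
Lemma count_restart S T n w : In (walk d xi S w) (Vbox d n) ->
  count_in_box d (visited (increments xi S T w)) n <=
  count_in_box d (visited (increments xi 0 (S + T) w)) (Datatypes.S n).
Proof.
  intros HS; unfold count_in_box.
  pose proof (walk_length d F P xi mu Hxi S w) as LS.
  apply Rle_trans with (lsum (fun x => ind (visited (increments xi 0 (S + T) w) x))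
                             (map (vadd (walk d xi S w)) (Vbox d n))).
  - rewrite lsum_map; apply lsum_le; intros x Hx; apply ind_le; intros Hv.
    apply visited_increments in Hv; destruct Hv as [k [Hk <-]].
    apply visited_walk; exists (S + k)%nat; split; [lia|].
    apply (walk_add d F P xi mu Hxi).
  - apply lsum_incl.
    + apply NoDup_map_NoDup_ForallPairs; [|apply NoDup_Vbox].
      intros x y Hx Hy E; apply Vbox_length in Hx, Hy.
      apply vadd_eq_iff in E; rewrite ?(vadd_length d); try congruence.
      rewrite E; symmetry; apply vadd_eq_iff; rewrite ?(vadd_length d); congruence.
    + intros z Hz; apply in_map_iff in Hz; destruct Hz as [x [<- Hx]].
      now apply Vbox_vadd.
    + intros x _; apply ind_bounds.
Qed.

(** The restart time is fixed before the scale, so the displacement it causes is small compared with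
    the scale, outside an event of small probability. *)
Lemma walk_in_large_box S delta : 0 < delta ->
  exists N, forall n, (N <= n)%nat -> P (fun w => ~ In (walk d xi S w) (Vbox d n)) <= delta.
Proof.
  intros Hd.
  assert (HF : forall n, F (fun w => In (walk d xi S w) (Vbox d n)))
    by (intros n; apply (F_walk d F P xi mu HP Hxi S (fun x => In x (Vbox d n)))).
  destruct (P_ex_approx F P HP (fun n w => In (walk d xi S w) (Vbox d n)) delta HF Hd)
    as [N HN].
  replace (fun w => exists n, In (walk d xi S w) (Vbox d n)) with (fun _ : Omega => True) in HN.
  2:{ apply event_ext; intros w; split; auto; intros _.
      apply Vbox_exhaust, (walk_length d F P xi mu Hxi). }
  rewrite (P_True F P HP) in HN.
  exists N; intros n Hn; rewrite (P_not F P HP) by auto.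
  assert (P (fun w => exists m, (m <= N)%nat /\ In (walk d xi S w) (Vbox d m)) <=
          P (fun w => In (walk d xi S w) (Vbox d n))); [|lra].
  apply (P_mono F P HP); auto.
  - now apply (F_ex_le F P HP (fun m w => In (walk d xi S w) (Vbox d m))).
  - intros w [m [Hm Hw]]; apply (Vbox_mono d m n); auto; lia.
Qed.

(* Restarting the walk at a late time [S] gives a fresh, independent chance
   of at least [c], so the probability [p] of ever succeeding satisfies
   [p >= p + c (1 - p)]. *)
Lemma exceed_almost_surely (thr : nat -> R) (c : R) N0 : 0 < c ->
  (forall N, exists n, (N <= n)%nat /\ exists T,
      c <= P (fun w => thr n <= count_in_box d (visited (increments xi 0 T w)) n)) ->
  almost_surely F P (fun w => exists n, (N0 <= n)%nat /\
      thr n <= count_in_box d (range_of d xi w) (S n)).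
Proof.
  intros Hc Hgood.
  set (h := fun zs => exists n, (N0 <= n)%nat /\ thr n <= count_in_box d (visited zs) (S n)).
  set (H := fun S w => h (increments xi 0 S w)).
  assert (HF : forall S, F (H S)) by (intros S; apply (F_increments d F P xi mu HP Hxi 0 S h)).
  assert (HFE : F (fun w => exists S, H S w)) by now apply (F_ex F P HP).
  assert (Hmono : forall S S' w, (S <= S')%nat -> H S w -> H S' w).
  { intros S S' w HS [n [Hn Hthr]]; exists n; split; auto.
    eapply Rle_trans; [exact Hthr|]; apply count_in_box_mono; intros x Hx.
    apply visited_walk in Hx; apply visited_walk; destruct Hx as [k [Hk Hx]].
    exists k; split; auto; lia. }
  apply (almost_surely_impl F P (fun w => exists S, H S w)).
  { intros w [S [n [Hn Hthr]]]; exists n; split; auto.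
    eapply Rle_trans; [exact Hthr|]; apply count_in_box_mono; intros x.
    apply visited_range. }
  apply (almost_surely_lower F P HP); auto.
  intros eps Heps; set (p := P (fun w => exists S, H S w)).
  (* Half of the error [c * eps] pays for replacing [p] by [P (H S)], the other half for the walk
     being outside the box at time [S]. *)
  set (delta := c * eps / 2).
  assert (Hdelta : 0 < delta) by (unfold delta; nra).
  destruct (P_ex_approx F P HP H delta HF Hdelta) as [S HS]; fold p in HS.
  replace (fun w => exists n, (n <= S)%nat /\ H n w) with (H S) in HS.
  2:{ apply event_ext; intros w; split; [intros Hw; now exists S|].
      intros [n [Hn Hw]]; eapply Hmono; eauto. }
  destruct (walk_in_large_box S delta Hdelta) as [N1 HN1].
  (* The scale is chosen after [S]: late enough to count as a success and large enough for the box
     to contain the position at time [S]. *)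
  destruct (Hgood (Nat.max N0 N1)) as [n [Hn [T HT]]].
  specialize (HN1 n ltac:(lia)).
  set (b := fun zs => thr n <= count_in_box d (visited zs) n).
  set (A := fun w => b (increments xi S T w)).
  set (U := fun w => In (walk d xi S w) (Vbox d n)).
  change (P (fun w => ~ U w) <= delta) in HN1.
  assert (FA : F A) by (apply (F_increments d F P xi mu HP Hxi S T b)).
  assert (FU : F U) by (apply (F_walk d F P xi mu HP Hxi S (fun x => In x (Vbox d n)))).
  assert (FnH : F (fun w => ~ H S w)) by now apply (F_not F P HP).
  assert (Hind : P (fun w => ~ H S w /\ A w) = (1 - P (H S)) * P (fun w => b (increments xi 0 T w))).
  { rewrite <- (P_not F P HP) by auto.
    apply (P_increments_indep d F P xi mu HP Hxi S T (fun zs => ~ h zs) b). }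
  assert (Hp1 : P (H S) <= 1) by now apply (P_le_1 F P HP).
  assert (FHA : F (fun w => ~ H S w /\ A w)) by now apply (F_and F P HP).
  assert (Hp : P (H S) + (P (fun w => ~ H S w /\ A w) - delta) <= p).
  { apply Rle_trans with (P (H S) + P (fun w => (~ H S w /\ A w) /\ U w)).
    - rewrite (P_split F P HP (fun w => ~ H S w /\ A w) U) by auto.
      assert (P (fun w => (~ H S w /\ A w) /\ ~ U w) <= P (fun w => ~ U w)); [|lra].
      apply (P_mono F P HP); try tauto.
      + apply (F_and F P HP); auto; now apply (F_not F P HP).
      + now apply (F_not F P HP).
    - rewrite <- (P_or F P HP); auto; try tauto; [|now apply (F_and F P HP)].
      apply (P_mono F P HP); auto.
      + apply (F_or F P HP); auto; now apply (F_and F P HP).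
      + intros w [Hw|[[_ Hw] HU]]; [now exists S|].
        exists (S + T)%nat, n; split; [lia|].
        eapply Rle_trans; [exact Hw|]; now apply count_restart. }
  rewrite Hind in Hp; fold b in HT.
  assert (Hp2 : p <= 1) by now apply (P_le_1 F P HP).
  assert (HS2 : P (H S) <= p)
    by (apply (P_mono F P HP); auto; intros w Hw; now exists S).
  assert ((1 - P (H S)) * c <= (1 - P (H S)) * P (fun w => b (increments xi 0 T w)))
    by (apply Rmult_le_compat_l; auto; lra).
  assert ((1 - p) * c <= (1 - P (H S)) * c) by (apply Rmult_le_compat_r; lra).
  assert (Hfin : (1 - p) * c <= eps * c) by (unfold delta in *; lra).
  apply Rmult_le_reg_r in Hfin; auto; lra.
Qed.

(** * The two bounds on the dimension *)

Lemma range_count_ge_1 w n : 1 <= count_in_box d (range_of d xi w) n.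
Proof. apply count_in_box_ge_1; now exists 0%nat. Qed.

Lemma log2_count_nonneg w n : 0 <= log2 (count_in_box d (range_of d xi w) n).
Proof.
  replace 0 with (log2 1) by (unfold log2; rewrite ln_1; lra).
  apply log2_le; [lra|apply range_count_ge_1].
Qed.

Lemma dimension_lower gamma gamma0 : 0 <= gamma0 < gamma -> gamma <= INR d ->
  ~ green_sum_finite d G gamma ->
  almost_surely F P (fun w => forall N, exists n, (N <= n)%nat /\
     gamma0 < log2 (count_in_box d (range_of d xi w) n) / INR n).
Proof.
  intros Hg0 Hgd Hinf.
  (* The gap between [gamma0] and the midpoint absorbs the factor [4 * G0] of the threshold and the
     shift from scale [n] to [S n]. *)
  set (gamma' := (gamma0 + gamma) / 2).
  set (r := Rpower 2 gamma').
  assert (Hr : 0 < r) by apply exp_pos.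
  set (G0 := G (zerov d)).
  pose proof green_origin_ge_1 as HG0; fold G0 in HG0.
  set (thr := fun n => r ^ n / (4 * G0)).
  set (K := 2 * 2 ^ d).
  assert (HK : 0 < K) by (unfold K; pose proof (pow_lt 2 d); lra).
  apply (almost_surely_impl F P (fun w => forall N, exists n, (N <= n)%nat /\
           thr n <= count_in_box d (range_of d xi w) (S n))).
  - intros w Hw N.
    set (L := log2 (4 * G0)).
    destruct (archimed_nat ((gamma0 + L) / (gamma' - gamma0))) as [M HM].
    destruct (Hw (Nat.max N M)) as [n [Hn Hthr]]; exists (S n); split; [lia|].
    apply log2_le in Hthr.
    2:{ unfold thr; apply Rdiv_lt_0_compat; [now apply pow_lt|lra]. }
    assert (E : log2 (thr n) = INR n * gamma' - L).
    { unfold L, thr, log2, Rdiv at 2.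
      rewrite ln_mult, ln_Rinv, ln_pow; try lra;
        [|now apply pow_lt|apply Rinv_0_lt_compat; lra].
      unfold r; rewrite ln_Rpower; pose proof ln_2_pos; field; lra. }
    assert (HMn : INR M <= INR n) by (apply le_INR; lia).
    assert (gamma0 + L < INR n * (gamma' - gamma0)).
    { assert (Hgap : 0 < gamma' - gamma0) by (unfold gamma'; lra).
      apply Rlt_le_trans with (INR M * (gamma' - gamma0)); [|apply Rmult_le_compat_r; lra].
      apply (Rmult_lt_compat_r (gamma' - gamma0)) in HM; auto.
      unfold Rdiv in HM; rewrite Rmult_assoc, Rinv_l, Rmult_1_r in HM; lra. }
    pose proof (pos_INR n); rewrite S_INR.
    apply (Rmult_lt_reg_r (INR n + 1)); [lra|].
    unfold Rdiv; rewrite Rmult_assoc, Rinv_l, Rmult_1_r by lra; lra.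
  - apply (almost_surely_all F P HP (fun N w => exists n, (N <= n)%nat /\
           thr n <= count_in_box d (range_of d xi w) (S n))).
    intros N0; apply (exceed_almost_surely thr (/ (16 * K * G0 ^ 2))).
    + apply Rinv_0_lt_compat; assert (0 < G0 ^ 2) by (apply pow_lt; lra); nra.
    + intros N.
      destruct (doubling_scales gamma gamma' ltac:(unfold gamma'; lra)
                  ltac:(unfold gamma'; lra) Hinf N) as [n [Hn [Hlow Hdoub]]].
      destruct (truncated_green_box_approx n) as [T HT].
      exists n; split; auto; exists T.
      eapply Rle_trans; [apply (paley_zygmund n T K HK Hdoub HT)|].
      apply (P_mono F P HP).
      * apply (F_increments d F P xi mu HP Hxi 0 T
                 (fun zs => green_box n / (4 * G (zerov d)) <= count_in_box d (visited zs) n)).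
      * apply (F_increments d F P xi mu HP Hxi 0 T
                 (fun zs => thr n <= count_in_box d (visited zs) n)).
      * intros w Hw; eapply Rle_trans; [|exact Hw].
        apply Rmult_le_compat_r; [left; apply Rinv_0_lt_compat; fold G0; lra|exact Hlow].
Qed.

(** * Measurability and first moment of the full count *)

Lemma F_range x : F (fun w => range_of d xi w x).
Proof.
  apply (F_ex F P HP (fun n w => walk d xi n w = x)).
  intros n; apply (F_walk d F P xi mu HP Hxi n (fun y => y = x)).
Qed.

Lemma P_range_le x : length x = d -> P (fun w => range_of d xi w x) <= G x.
Proof.
  intros Hx; assert (HF : forall n, F (fun w => walk d xi n w = x))
    by (intros n; apply (F_walk d F P xi mu HP Hxi n (fun y => y = x))).
  apply (P_ex_bound F P HP (fun n w => walk d xi n w = x)); auto.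
  intros T; eapply Rle_trans; [apply (P_ex_le_sum F P HP (fun n w => walk d xi n w = x)); auto|].
  now apply truncated_green_le_green.
Qed.

(** Splitting on whether the first point of the list is visited lowers the threshold by 1 or leaves
    it unchanged; hence the induction with [t] general. *)
Lemma F_count n t : F (fun w => t <= count_in_box d (range_of d xi w) n).
Proof.
  unfold count_in_box; revert t; induction (Vbox d n) as [|x l IH]; intros t.
  - exact (F_const F P HP (t <= 0)).
  - replace (fun w => t <= lsum (fun y => ind (range_of d xi w y)) (x :: l))
      with (fun w => (range_of d xi w x /\
                      t - 1 <= lsum (fun y => ind (range_of d xi w y)) l) \/
                     (~ range_of d xi w x /\
                      t <= lsum (fun y => ind (range_of d xi w y)) l)).
    + apply (F_or F P HP); apply (F_and F P HP); auto using F_range.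
      apply (F_not F P HP), F_range.
    + apply event_ext; intros w.
      change (lsum (fun y => ind (range_of d xi w y)) (x :: l)) with
        (ind (range_of d xi w x) + lsum (fun y => ind (range_of d xi w y)) l).
      destruct (classic (range_of d xi w x)) as [Hx|Hx].
      * rewrite ind_true by auto; split; [intros [[_ H]|[H _]]; [lra|tauto]|].
        intros H; left; split; auto; lra.
      * rewrite ind_false by auto; split; [intros [[H _]|[_ H]]; [tauto|lra]|].
        intros H; right; split; auto; lra.
Qed.

Lemma P_count_markov n t : 0 < t ->
  P (fun w => t <= count_in_box d (range_of d xi w) n) <= green_box n / t.
Proof.
  intros Ht.
  set (D := fun w => t <= count_in_box d (range_of d xi w) n).
  (* The list encodes the count minus [t * 1_D], which is nonnegative pointwise. *)
  set (l := (- t, D) :: map (fun x => (1, fun w => range_of d xi w x)) (Vbox d n)).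
  assert (Hlin : 0 <= 0 + lsum (fun ca => fst ca * P (snd ca)) l).
  { apply (P_linear_nonneg F P HP).
    - intros ca [<-|Hca]; [apply F_count|].
      apply in_map_iff in Hca; destruct Hca as [x [<- _]]; apply F_range.
    - intros w; unfold l.
      change (lsum (fun ca => fst ca * ind (snd ca w)) ((- t, D) :: ?l)) with
        (- t * ind (D w) + lsum (fun ca => fst ca * ind (snd ca w)) l).
      rewrite lsum_map; cbn [fst snd]; rewrite lsum_scal.
      fold (count_in_box d (range_of d xi w) n).
      pose proof (range_count_ge_1 w n).
      destruct (classic (D w)) as [Hw|Hw].
      + rewrite ind_true by auto; unfold D in Hw; lra.
      + rewrite ind_false by auto; lra. }
  unfold l in Hlin; change (lsum (fun ca => fst ca * P (snd ca)) ((- t, D) :: ?l)) with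
        (- t * P D + lsum (fun ca => fst ca * P (snd ca)) l) in Hlin.
  rewrite lsum_map in Hlin; cbn [fst snd] in Hlin; rewrite lsum_scal in Hlin.
  assert (lsum (fun x => P (fun w => range_of d xi w x)) (Vbox d n) <= green_box n).
  { apply lsum_le; intros x Hx; eapply P_range_le, Vbox_length, Hx. }
  apply (Rmult_le_reg_r t); auto.
  unfold Rdiv; rewrite Rmult_assoc, Rinv_l, Rmult_1_r by lra; lra.
Qed.

Lemma dimension_upper gamma gamma1 : 0 <= gamma < gamma1 -> green_sum_finite d G gamma ->
  almost_surely F P (fun w => exists N, forall n, (N <= n)%nat ->
     log2 (count_in_box d (range_of d xi w) n) / INR n < gamma1).
Proof.
  intros Hg Hfin.
  destruct (green_box_growth gamma ltac:(lra) Hfin) as [C HC].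
  (* Above [gamma], so that the Markov bounds decay geometrically with ratio [r / r']; below
     [gamma1], so that the final inequality is strict. *)
  set (gamma' := (gamma + gamma1) / 2).
  set (r := Rpower 2 gamma) in *; set (r' := Rpower 2 gamma').
  assert (Hr : 0 < r) by apply exp_pos.
  assert (Hr' : 0 < r') by apply exp_pos.
  assert (Hrr : r < r') by (apply Rpower_lt; unfold gamma'; lra).
  apply (almost_surely_impl F P (fun w => exists N, forall n, (N <= n)%nat ->
     ~ r' ^ n <= count_in_box d (range_of d xi w) n)).
  (* Starting from [S N] excludes [n = 0], where the quotient by [INR n] is meaningless. *)
  - intros w [N HN]; exists (S N); intros n Hn; specialize (HN n ltac:(lia)).
    apply Rnot_le_lt, Rlt_le, log2_le in HN;
      [|pose proof (range_count_ge_1 w n); lra].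
    rewrite log2_pow in HN by auto; unfold r' in HN; rewrite log2_Rpower in HN.
    assert (Hpos : 0 < INR n) by (apply lt_0_INR; lia).
    apply (Rmult_lt_reg_r (INR n)); auto.
    unfold Rdiv; rewrite Rmult_assoc, Rinv_l, Rmult_1_r by lra.
    eapply Rle_lt_trans; [exact HN|]; rewrite Rmult_comm.
    apply Rmult_lt_compat_r; auto; unfold gamma'; lra.
  - apply (borel_cantelli F P HP (fun n w => r' ^ n <= count_in_box d (range_of d xi w) n)
             C (r / r')).
    + split; [left; now apply Rdiv_lt_0_compat|].
      apply (Rmult_lt_reg_r r'); auto; unfold Rdiv.
      rewrite Rmult_assoc, Rinv_l, Rmult_1_r, Rmult_1_l by lra; auto.
    + intros n; apply F_count.
    + intros n; eapply Rle_trans; [apply P_count_markov; now apply pow_lt|].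
      unfold Rdiv; rewrite Rpow_mult_distr, pow_inv, <- Rmult_assoc.
      apply Rmult_le_compat_r; auto; left; apply Rinv_0_lt_compat; now apply pow_lt.
Qed.

(** The case of the convention [inf = d]: the box has [2^(d (n + 1))] points, and the surplus
    [d / n] in the quotient vanishes in the limit. *)
Lemma dimension_upper_trivial gamma1 w : INR d < gamma1 ->
  exists N, forall n, (N <= n)%nat ->
     log2 (count_in_box d (range_of d xi w) n) / INR n < gamma1.
Proof.
  intros Hg; destruct (archimed_nat (INR d / (gamma1 - INR d))) as [N HN].
  exists (S N); intros n Hn.
  assert (Hpos : 0 < INR n) by (apply lt_0_INR; lia).
  assert (HNn : INR N <= INR n) by (apply le_INR; lia).
  apply (Rmult_lt_reg_r (INR n)); auto.
  unfold Rdiv; rewrite Rmult_assoc, Rinv_l, Rmult_1_r by lra.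
  apply Rle_lt_trans with (INR d * (INR n + 1)).
  - eapply Rle_trans; [apply log2_le, count_in_box_le|].
    + pose proof (range_count_ge_1 w n); lra.
    + rewrite log2_pow by (pose proof (pow_lt 2 n); lra).
      change (2 * 2 ^ n) with (2 ^ S n); rewrite log2_pow, S_INR by lra.
      unfold log2 at 1; right; field; pose proof ln_2_pos; lra.
  - apply (Rmult_lt_compat_r (gamma1 - INR d)) in HN; [|lra].
    unfold Rdiv in HN; rewrite Rmult_assoc, Rinv_l, Rmult_1_r in HN by lra.
    nra.
Qed.

Lemma range_dimension gc : is_gamma_c d G gc ->
  almost_surely F P (fun w => upper_mink_dim_eq d (range_of d xi w) gc).
Proof.
  intros Hgc.
  assert (Hlow : forall gamma0, gamma0 < gc ->
    almost_surely F P (fun w => forall N, exists n, (N <= n)%nat /\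
     gamma0 < log2 (count_in_box d (range_of d xi w) n) / INR n)).
  (* A negative [gamma0], which occurs when [gc] is 0, is outside the scope of the growth argument;
     there the count being at least 1 suffices. *)
  { intros gamma0 Hg0; destruct (Rlt_or_le gamma0 0) as [Hneg|Hpos].
    - apply (almost_surely_true F P HP); intros w N; exists (S N); split; [lia|].
      eapply Rlt_le_trans; [exact Hneg|].
      apply Rmult_le_pos; [apply log2_count_nonneg|].
      left; apply Rinv_0_lt_compat, lt_0_INR; lia.
    (* A point of [(0, d)] strictly below the infimum, so its series diverges. *)
    - set (gamma := (gamma0 + gc) / 2).
      assert (Hgd : gc <= INR d).
      { destruct Hgc as [[_ ->]|[[g Hg] [Hlb _]]]; [lra|].
        specialize (Hlb g Hg); destruct Hg as [Hg _]; lra. }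
      apply (dimension_lower gamma); [unfold gamma; lra|unfold gamma; lra|].
      intros Hfin.
      assert (Hcrit : crit_set d G gamma) by (split; auto; unfold gamma; lra).
      destruct Hgc as [[Hno _]|[_ [Hlb _]]]; [exact (Hno gamma Hcrit)|].
      specialize (Hlb gamma Hcrit); unfold gamma in Hlb; lra. }
  assert (Hup : forall gamma1, gc < gamma1 ->
    almost_surely F P (fun w => exists N, forall n, (N <= n)%nat ->
     log2 (count_in_box d (range_of d xi w) n) / INR n < gamma1)).
  { intros gamma1 Hg1; destruct Hgc as [[_ ->]|[_ [_ Hglb]]].
    - apply (almost_surely_true F P HP); intros w; now apply dimension_upper_trivial.
    - assert (E : exists g, crit_set d G g /\ g < gamma1).
      { apply NNPP; intros Hc; assert (gamma1 <= gc); [|lra].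
        apply Hglb; intros g Hg; apply Rnot_lt_le; intros Hlt; apply Hc; eauto. }
      destruct E as [g [[Hg Hfin] Hlt]]; apply (dimension_upper g); auto; lra. }
  (* A sequence of tolerances tending to 0 reduces the limsup to countably many almost sure
     statements. *)
  set (e := fun k => / (INR k + 1)).
  assert (He : forall k, 0 < e k)
    by (intros k; apply Rinv_0_lt_compat; pose proof (pos_INR k); lra).
  assert (Hsmall : forall eps, 0 < eps -> exists k, e k < eps).
  { intros eps Heps; destruct (archimed_nat (/ eps)) as [k Hk]; exists k.
    unfold e; rewrite <- (Rinv_inv eps); apply Rinv_lt_contravar; [|lra].
    pose proof (Rinv_0_lt_compat eps Heps); pose proof (pos_INR k); nra. }
  assert (HU := almost_surely_all F P HP _ (fun k => Hup (gc + e k) ltac:(specialize (He k); lra))).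
  assert (HL := almost_surely_all F P HP _ (fun k => Hlow (gc - e k) ltac:(specialize (He k); lra))).
  apply (almost_surely_impl F P) with (2 := almost_surely_and F P HP _ _ HU HL).
  intros w [Hw1 Hw2]; split.
  - intros eps Heps; destruct (Hsmall eps Heps) as [k Hk].
    destruct (Hw1 k) as [N HN]; exists N; intros n Hn; specialize (HN n Hn); lra.
  - intros eps Heps N; destruct (Hsmall eps Heps) as [k Hk].
    destruct (Hw2 k N) as [n [Hn HN]]; exists n; split; auto; lra.
Qed.

End Transient.

Theorem theorem6p1
  (d : nat) (Omega : Type) (F : event Omega -> Prop) (P : event Omega -> R)
  (xi : nat -> Omega -> list Z) (mu : list Z -> R) (G : list Z -> R) (gc : R)
  (HP : is_prob_space Omega F P)
  (Hxi : iid_increments d F P xi mu)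
  (HG : green_function d P xi G)
  (Hgc : is_gamma_c d G gc) :
  exists A : event Omega, F A /\ P A = 1 /\
    forall w, A w -> upper_mink_dim_eq d (range_of d xi w) gc.
Proof. exact (range_dimension d F P xi mu G HP Hxi HG gc Hgc). Qed.
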